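(* The set $\mathcal{S}_{\mathrm R}$ is a basis of $\mathbb{S}_3^{\mathrm R}(\Delta_{\mathrm{PS}})$. Every $S \in \mathbb{S}_3^{\mathrm R}(\Delta_{\mathrm{PS}})$ can be uniquely expressed as $$S = \sum_{v_i \in V} \sum_{r = 1}^3 \beta_{i,r}^v(S) B_{i,r}^v + \sum_{t_{ijk} \in T_{\mathrm S}} \beta_{ijk}^t(S) B_{ijk}^t + \sum_{e_{ij} \in E} \ \sum_{t_{ijk} \in T_{ij}^e \setminus T_{\mathrm S}} \beta_{ij,k}^e(S) B_{ij,k}^e + \sum_{e_{ij} \in E^b} \beta_{ij}^e(S) B_{ij}^e .$$
   Context: Triangulation. $\Omega\subset\mathbb{R}^2$ is a polygonal domain and $\Delta=(V,E,T)$ is a triangulation of it: $V=\{v_i\}$ is a finite set of vertices (points), $E=\{e_{ij}\}$ a finite set of edges $e_{ij}=[v_i,v_j]$ and $T=\{t_{ijk}\}$ a finite set of nondegenerate triangles $t_{ijk}=[v_i,v_j,v_k]$, where $[\cdot]$ denotes the convex hull. The union of the triangles is $\Omega$, two different triangles intersect in the empty set, an element of $V$ or an element of $E$, and every vertex and edge belongs to at least one triangle. $E^b\subseteq E$ is the set of edges on the boundary of $\Omega$; an edge of $E\setminus E^b$ is shared by two triangles, an edge of $E^b$ belongs to one. Index convention: indices not separated by a comma may be permuted ($a_{ij}=a_{ji}$, $a_{ij,k}=a_{ji,k}$), while the order of comma-separated indices matters. Powell--Sabin refinement. $\Delta_{\mathrm{PS}}=(V_{\mathrm{PS}},E_{\mathrm{PS}},T_{\mathrm{PS}})$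 is obtained as follows. A split point $v_{ijk}$ is chosen inside each $t_{ijk}\in T$ so that for every interior edge $e_{ij}$ shared by $t_{ijk},t_{ijk'}\in T$ the segment $[v_{ijk},v_{ijk'}]$ intersects $e_{ij}$ in a point $v_{ij}$ inside $e_{ij}$; for $e_{ij}\in E^b$, $v_{ij}$ is an arbitrary point inside $e_{ij}$. Each $t_{ijk}$ is split into six triangles: $t_{i,j,k}=[v_i,v_{ij},v_{ijk}]$ and the triangles $t_{j,i,k},t_{j,k,i},t_{k,j,i},t_{k,i,j},t_{i,k,j}$ defined by the same rule ($t_{a,b,c}=[v_a,v_{ab},v_{abc}]$). These form $T_{\mathrm{PS}}$. Also $e_{i,j}=[v_i,v_{ij}]$, and $E^b_{\mathrm{PS}}$ is the set of all such half-edges $e_{i,j},e_{j,i}$ with $e_{ij}\in E^b$. Blossom. $\mathbb{P}_3$ is the space of bivariate polynomials of total degree at most 3. For $P\in\mathbb{P}_3$, the blossom $\mathcal{B}[P]:(\mathbb{R}^2)^3\to\mathbb{R}$ is the unique symmetric map that is affine in each argument and satisfies $\mathcal{B}[P](p,p,p)=P(p)$. For a spline $S$, $\mathcal{B}[S|_{t}]$ is the blossom of the polynomial coinciding with $S$ on $t$; for a half-edge $e_{i,j}\in E^b_{\mathrm{PS}}$, $\mathcal{B}[S|_{e_{i,j}}](v_i,v_j,v_{ij})$ is the blossom of the polynomial piece on the triangle of $T_{\mathrm{PS}}$ containing $e_{i,j}$. Spline space and its basis. $\mathbb{S}_3^1(\Delta_{\mathrm{PS}})=\{S\in C^1(\Omega):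 S|_{t}\in\mathbb{P}_3 \text{ for all } t\in T_{\mathrm{PS}}\}$. For each $v_i\in V$ fix a triangle $[q^v_{i,1},q^v_{i,2},q^v_{i,3}]$ containing $v_i$, all points $\frac23v_i+\frac13v_{ijk}$ ($t_{ijk}\in T$ with vertex $v_i$) and all points $\frac23v_i+\frac13v_{ij}$ ($e_{ij}\in E$ with endpoint $v_i$). Define the functionals $\beta^v_{i,r}(S)=\mathcal{B}[S|_{t_{i,j,k}}](v_i,v_i,v_i+3(q^v_{i,r}-v_i))$ for $v_i\in V$, $r=1,2,3$ (with any $t_{i,j,k}\in T_{\mathrm{PS}}$ having a vertex at $v_i$; independent of the choice); $\beta^t_{i,j,k}(S)=\mathcal{B}[S|_{t_{i,j,k}}](v_i,v_j,v_{ijk})$ for $t_{i,j,k}\in T_{\mathrm{PS}}$; $\beta^e_{i,j}(S)=\mathcal{B}[S|_{e_{i,j}}](v_i,v_j,v_{ij})$ for $e_{i,j}\in E^b_{\mathrm{PS}}$. It is known that these functionals form a basis of the dual space of $\mathbb{S}_3^1(\Delta_{\mathrm{PS}})$; let $B^v_{i,r}$, $B^t_{i,j,k}$, $B^e_{i,j}$ be the corresponding dual basis of $\mathbb{S}_3^1(\Delta_{\mathrm{PS}})$ (each function has value 1 under its own functional and 0 under all the others). Symmetric triangles. $T_{\mathrm S}\subseteq T$ is the set of symmetrically refined triangles $t_{ijk}$, i.e. those for which each of the triples $(v_k,v_{ijk},v_{ij})$, $(v_j,v_{ijk},v_{ki})$, $(v_i,v_{ijk},v_{jk})$ is collinear.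 Combined functions. For $e_{ij}\in E$ and a triangle $t_{ijk}$ attached to $e_{ij}$ put $w_{ij,k}=v_k$ if $t_{ijk}\in T_{\mathrm S}$ and $w_{ij,k}=v_{ijk}$ otherwise. If $e_{ij}\in E\setminus E^b$ is shared by $t_{ijk},t_{ijk'}$, let $\omega_{ij,k},\omega_{ij,k'}\in[0,1]$ satisfy $v_{ijk}=(1-\omega_{ij,k})w_{ij,k}+\omega_{ij,k}w_{ij,k'}$ and $v_{ijk'}=(1-\omega_{ij,k'})w_{ij,k'}+\omega_{ij,k'}w_{ij,k}$, and set $B^e_{ij,k}=(1-\omega_{ij,k})(B^t_{i,j,k}+B^t_{j,i,k})+\omega_{ij,k'}(B^t_{i,j,k'}+B^t_{j,i,k'})$ (and $B^e_{ij,k'}$ by exchanging $k$ and $k'$). If $e_{ij}\in E^b$ belongs to $t_{ijk}$, let $\omega_{ij,k}\in[0,1]$ satisfy $v_{ijk}=(1-\omega_{ij,k})w_{ij,k}+\omega_{ij,k}v_{ij}$, and set $B^e_{ij,k}=(1-\omega_{ij,k})(B^t_{i,j,k}+B^t_{j,i,k})$ and $B^e_{ij}=(B^e_{i,j}+B^e_{j,i})+\omega_{ij,k}(B^t_{i,j,k}+B^t_{j,i,k})$. For $t_{ijk}\in T_{\mathrm S}$ set $B^t_{ijk}=B^e_{ij,k}+B^e_{jk,i}+B^e_{ki,j}$. Reduced space. Let $T^e_{ij}\subseteq T$ be the set of triangles attached to $e_{ij}$. The set $\mathcal{S}_{\mathrm R}$ consists of: $B^v_{i,r}$ for $v_i\in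 V$, $r\in\{1,2,3\}$; $B^t_{ijk}$ for $t_{ijk}\in T_{\mathrm S}$; $B^e_{ij,k}$ for $e_{ij}\in E$ and $t_{ijk}\in T^e_{ij}\setminus T_{\mathrm S}$; $B^e_{ij}$ for $e_{ij}\in E^b$. $\mathbb{S}_3^{\mathrm R}(\Delta_{\mathrm{PS}})$ is the vector space spanned by $\mathcal{S}_{\mathrm R}$. Functionals on the reduced space. For $S\in\mathbb{S}_3^{\mathrm R}(\Delta_{\mathrm{PS}})$: $\beta^v_{i,r}(S)=\mathcal{B}[S|_{t_{i,j,k}}](v_i,v_i,v_i+3(q^v_{i,r}-v_i))$ for $v_i\in V$, $r=1,2,3$ (with any $t_{i,j,k}\in T_{\mathrm{PS}}$ having a vertex at $v_i$; independent of the choice); $\beta^t_{ijk}(S)=\mathcal{B}[S|_{t_{i,j,k}}](v_i,v_j,v_k)$ for $t_{ijk}\in T_{\mathrm S}$; $\beta^e_{ij,k}(S)=\mathcal{B}[S|_{t_{i,j,k}}](v_i,v_j,v_{ijk})$ for $e_{ij}\in E$ and $t_{ijk}\in T^e_{ij}\setminus T_{\mathrm S}$; $\beta^e_{ij}(S)=\mathcal{B}[S|_{e_{i,j}}](v_i,v_j,v_{ij})$ for $e_{ij}\in E^b$. (On $\mathbb{S}_3^{\mathrm R}(\Delta_{\mathrm{PS}})$ these do not depend on the order in which the uncomma-ed indices are taken.) *)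

(* Defs.v *)
From mathcomp Require Import all_boot all_order all_algebra.
From mathcomp Require Import all_classical all_reals all_analysis.
From mathcomp Require mpoly.
Export -(notations) mpoly.

Set Implicit Arguments.
Unset Strict Implicit.
Unset Printing Implicit Defensive.

Import Order.TTheory GRing.Theory Num.Theory numFieldNormedType.Exports.
Local Open Scope classical_set_scope.
Local Open Scope ring_scope.

Notation plane R := 'rV[R]_2.

(* Index conventions.  Vertices are indexed by a finite type I.  Indices that
   may be permuted are gathered in a set and comma-separated indices stay
   separate: v_ij is [vE [set i; j]], v_ijk is [vT [set i; j; k]],
   omega_{ij,k} is [om [set i; j] k] and B^t_{i,j,k} is [B (DT i j k)].  Since
   triangles have three vertices, [set i; j; k] \in tris forces i, j, k to be
   distinct, and then runs over all ordered labellings of the triangles. *)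
Notation "[ 'ix' i ; j ]" := [set i; j]%SET (format "[ 'ix'  i ;  j ]").
Notation "[ 'ix' i ; j ; k ]" := [set i; j; k]%SET
  (format "[ 'ix'  i ;  j ;  k ]").

Section LinearAlgebra.
Variables (R : realType) (V : lmodType R).

Definition span (A : set V) : set V :=
  [set u | exists (n : nat) (c : 'I_n -> R) (f : 'I_n -> V),
     (forall m, A (f m)) /\ u = \sum_(m < n) c m *: f m].

Definition lin_indep (A : set V) : Prop :=
  forall (n : nat) (f : 'I_n -> V), injective f -> (forall m, A (f m)) ->
  forall c : 'I_n -> R, \sum_(m < n) c m *: f m = 0 -> forall m, c m = 0.

Definition is_basis (A U : set V) : Prop := lin_indep A /\ span A = U.

End LinearAlgebra.

Section PlaneGeometry.
Variable R : realType.
Implicit Types (a b c p d x y z : plane R) (A : set (plane R)).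

Definition hull A : set (plane R) :=
  [set x | exists (n : nat) (w : 'I_n -> R) (a : 'I_n -> plane R),
     [/\ forall m, 0 <= w m, \sum_(m < n) w m = 1, forall m, A (a m)
       & x = \sum_(m < n) w m *: a m]].

Definition open_segment a b : set (plane R) :=
  [set x | exists s : R, 0 < s < 1 /\ x = (1 - s) *: a + s *: b].

Definition collinear a b c : Prop :=
  exists p d, forall x, [set a; b; c] x -> exists s : R, x = p + s *: d.

Definition frontier A : set (plane R) := closure A `\` interior A.

(* [msize] is one more than the total degree. *)
Definition cubic : set (plane R -> R) :=
  [set f | exists P : mpoly 2 R,
     (msize P <= 4)%N /\ forall x, f x = meval (x ord0) P].

Definition affine_fun (f : plane R -> R) : Prop :=
  forall x y (s : R), f ((1 - s) *: x + s *: y) = (1 - s) * f x + s * f y.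

Definition is_blossom (P : plane R -> R)
    (b : plane R -> plane R -> plane R -> R) : Prop :=
  [/\ forall x y z, b x y z = b y x z /\ b x y z = b x z y,
      [/\ forall y z, affine_fun (fun x => b x y z),
          forall x z, affine_fun (fun y => b x y z)
        & forall x y, affine_fun (fun z => b x y z)]
    & forall x, b x x x = P x].

(* Meaningful for P in [cubic], where the blossom exists and is unique. *)
Definition blossom (P : plane R -> R) : plane R -> plane R -> plane R -> R :=
  xget (fun _ _ _ => 0) [set b | is_blossom P b].

End PlaneGeometry.

Section Triangulation.
Variables (R : realType) (I : finType).

Record complex := Complex {
  pos : I -> plane R;
  edges : {set {set I}};
  tris : {set {set I}} }.

Variable D : complex.

Definition cell (s : {set I}) : set (plane R) := hull (pos D @` [set` s]).

Definition domain : set (plane R) :=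
  \bigcup_(t in [set t | t \in tris D]) cell t.

Definition attached (e : {set I}) : {set {set I}} :=
  [set t in tris D | e \subset t]%SET.

Definition bedges : {set {set I}} :=
  [set e in edges D | `[< cell e `<=` frontier domain >]]%SET.

(* No connectedness of the domain is required. *)
Record is_triangulation : Prop := IsTriangulation {
  pos_inj : injective (pos D);
  card_edge : forall e, e \in edges D -> #|e| = 2%N;
  card_tri : forall t, t \in tris D -> #|t| = 3%N;
  tri_nondegenerate : forall i j k, [ix i; j; k] \in tris D ->
    ~ collinear (pos D i) (pos D j) (pos D k);
  side_is_edge : forall i j k, [ix i; j; k] \in tris D ->
    [ix i; j] \in edges D;
  vertex_in_tri : forall i, exists2 t, t \in tris D & i \in t;
  edge_in_tri : forall e, e \in edges D -> exists2 t, t \in tris D & e \subset t;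
  tri_inter : forall t t', t \in tris D -> t' \in tris D -> t != t' ->
    [\/ cell t `&` cell t' = set0,
        exists i, cell t `&` cell t' = [set pos D i]
      | exists2 e, e \in edges D & cell t `&` cell t' = cell e];
  interior_edge_tris : forall e, e \in edges D -> e \notin bedges ->
    #|attached e| = 2%N;
  boundary_edge_tris : forall e, e \in bedges -> #|attached e| = 1%N }.

(* [R^o] makes the functions on the domain an R-module. *)
Local Notation fct := (domain -> R^o).

(* Differentiability is relative to the closed set [domain], with a gradient
   that is continuous up to the boundary. *)
Definition C1 (f : fct) : Prop :=
  exists g : domain -> plane R, continuous g /\
    forall (x : domain) (eps : R), 0 < eps ->
      \forall y \near x,
        `|f y - f x - \sum_(m < 2) g x ord0 m * (val y - val x) ord0 m|
          <= eps * `|val y - val x|.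

(* The polynomial piece of S on A; determined when A is a nondegenerate triangle
   on which S is cubic. *)
Definition piece (S : fct) (A : set (plane R)) : plane R -> R :=
  xget (fun=> 0) [set P | cubic P /\ forall x : domain, A (val x) -> S x = P (val x)].

Record split_points := SplitPoints {
  vT : {set I} -> plane R;
  vE : {set I} -> plane R }.

Variable P : split_points.

Record is_ps_refinement : Prop := IsPSRefinement {
  vT_inside : forall t, t \in tris D -> interior (cell t) (vT P t);
  vE_inside : forall i j, [ix i; j] \in edges D ->
    open_segment (pos D i) (pos D j) (vE P [ix i; j]);
  vE_interior : forall e t t', e \in edges D -> e \notin bedges ->
    t \in attached e -> t' \in attached e -> t != t' ->
    hull [set vT P t; vT P t'] `&` cell e = [set vE P e] }.

Definition ps_tri (i j k : I) : set (plane R) :=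
  hull [set pos D i; vE P [ix i; j]; vT P [ix i; j; k]].

Definition spline : set fct :=
  [set S | C1 S /\ forall i j k, [ix i; j; k] \in tris D ->
     exists2 p, cubic p &
       forall x : domain, ps_tri i j k (val x) -> S x = p (val x)].

(* B[S|_{t_{i,j,k}}] *)
Definition bl (S : fct) (i j k : I) : plane R -> plane R -> plane R -> R :=
  blossom (piece S (ps_tri i j k)).

Definition is_vertex_triangles (q : I -> 'I_3 -> plane R) : Prop :=
  forall i,
    [/\ ~ collinear (q i 0) (q i 1) (q i 2%:R),
        hull (range (q i)) (pos D i),
        forall t, t \in tris D -> i \in t ->
          hull (range (q i)) ((2 / 3) *: pos D i + (1 / 3) *: vT P t)
      & forall e, e \in edges D -> i \in e ->
          hull (range (q i)) ((2 / 3) *: pos D i + (1 / 3) *: vE P e)].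

(* Arbitrary choices of labels: [labV i] is a pair (j, k) such that t_{i,j,k} is
   a triangle at v_i; [labE] and [labT] order the vertices of edges and
   triangles. *)
Record labelling := Labelling {
  labV : I -> I * I;
  labE : {set I} -> I * I;
  labT : {set I} -> I * I * I }.

Record is_labelling (L : labelling) : Prop := IsLabelling {
  labV_tri : forall i, [ix i; (labV L i).1; (labV L i).2] \in tris D;
  labE_edge : forall e, e \in edges D ->
    e = [ix (labE L e).1; (labE L e).2];
  labT_tri : forall t, t \in tris D ->
    t = [ix (labT L t).1.1; (labT L t).1.2; (labT L t).2] }.

Variable q : I -> 'I_3 -> plane R.
Variable L : labelling.

(* Index k of the triangle t_ijk attached to e_ij; unique for boundary edges. *)
Definition third (i j : I) : I :=
  odflt i [pick k | [ix i; j; k] \in tris D].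

Definition betaV (S : fct) (i : I) (r : 'I_3) : R :=
  bl S i (labV L i).1 (labV L i).2
    (pos D i) (pos D i) (pos D i + 3 *: (q i r - pos D i)).

(* beta^t_{i,j,k}; on the reduced space also beta^e_{ij,k}. *)
Definition betaF (S : fct) (i j k : I) : R :=
  bl S i j k (pos D i) (pos D j) (vT P [ix i; j; k]).

(* beta^e_{i,j}; on the reduced space also beta^e_ij. *)
Definition betaB (S : fct) (i j : I) : R :=
  bl S i j (third i j) (pos D i) (pos D j) (vE P [ix i; j]).

(* beta^t_ijk of the reduced space. *)
Definition betaT (S : fct) (i j k : I) : R :=
  bl S i j k (pos D i) (pos D j) (pos D k).

Inductive dof : Type :=
  | DV of I & 'I_3
  | DT of I & I & I
  | DE of I & I.

Definition dof_valid (d : dof) : Prop :=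
  match d with
  | DV _ _ => True
  | DT i j k => [ix i; j; k] \in tris D
  | DE i j => [ix i; j] \in bedges
  end.

Definition beta (d : dof) (S : fct) : R :=
  match d with
  | DV i r => betaV S i r
  | DT i j k => betaF S i j k
  | DE i j => betaB S i j
  end.

(* Only the values at valid indices matter. *)
Variable B : dof -> fct.

Definition is_dual_basis : Prop :=
  is_basis [set B d | d in dof_valid] spline /\
  forall d, dof_valid d ->
    beta d (B d) = 1 /\
    forall d', dof_valid d' -> d' <> d -> beta d' (B d) = 0.

Definition symtris : {set {set I}} :=
  [set t in tris D | `[< forall i j k, t = [ix i; j; k] ->
     collinear (pos D k) (vT P t) (vE P [ix i; j]) >]]%SET.

(* w_{ij,k} for e = {i, j} *)
Definition wpt (e : {set I}) (k : I) : plane R :=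
  let t := (e :|: [set k])%SET in
  if t \in symtris then pos D k else vT P t.

Variable om : {set I} -> I -> R.

Record is_weights : Prop := IsWeights {
  om_itv : forall i j k, [ix i; j; k] \in tris D -> 0 <= om [ix i; j] k <= 1;
  om_interior : forall i j k k', [ix i; j] \in edges D ->
    [ix i; j] \notin bedges ->
    [ix i; j; k] \in tris D -> [ix i; j; k'] \in tris D -> k != k' ->
    vT P [ix i; j; k] = (1 - om [ix i; j] k) *: wpt [ix i; j] k
                        + om [ix i; j] k *: wpt [ix i; j] k';
  om_boundary : forall i j k, [ix i; j] \in bedges ->
    [ix i; j; k] \in tris D ->
    vT P [ix i; j; k] = (1 - om [ix i; j] k) *: wpt [ix i; j] k
                        + om [ix i; j] k *: vE P [ix i; j] }.

(* B^e_{ij,k}: the sum has the single term k' for an interior edge, and is empty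
   for a boundary edge. *)
Definition BEF (i j k : I) : fct :=
  (1 - om [ix i; j] k) *: (B (DT i j k) + B (DT j i k))
  + \sum_(k' | ([ix i; j; k'] \in tris D) && (k' != k))
      om [ix i; j] k' *: (B (DT i j k') + B (DT j i k')).

(* B^e_ij *)
Definition BEB (i j : I) : fct :=
  let k := third i j in
  (B (DE i j) + B (DE j i))
  + om [ix i; j] k *: (B (DT i j k) + B (DT j i k)).

(* B^t_ijk *)
Definition BTT (i j k : I) : fct := BEF i j k + BEF j k i + BEF k i j.

Definition SR : set fct :=
  [set f | [\/ exists i r, f = B (DV i r),
               exists i j k, [ix i; j; k] \in symtris /\ f = BTT i j k,
               exists i j k, [ix i; j; k] \in (tris D :\: symtris)%SET /\
                             f = BEF i j k
             | exists i j, [ix i; j] \in bedges /\ f = BEB i j]].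

Definition reduced_space : set fct := span SR.

Definition expansion (cV : I -> 'I_3 -> R) (cT : {set I} -> R)
    (cEF : {set I} -> I -> R) (cEB : {set I} -> R) : fct :=
  \sum_i \sum_(r < 3) cV i r *: B (DV i r)
  + \sum_(t in symtris)
      cT t *: BTT (labT L t).1.1 (labT L t).1.2 (labT L t).2
  + \sum_(e in edges D)
      \sum_(k | (e :|: [set k])%SET \in (tris D :\: symtris)%SET)
        cEF e k *: BEF (labE L e).1 (labE L e).2 k
  + \sum_(e in bedges) cEB e *: BEB (labE L e).1 (labE L e).2.

End Triangulation.

Notation fct R D := (domain D -> R^o).

(* Main.v *)
(* Write F_ijk for beta^t_{i,j,k}.  On a combination of the functions of S_R, let
   C(e,k) be the coefficient of B^t_ijk if t_ijk is symmetric and of B^e_{ij,k}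
   otherwise, for e = e_ij.  Duality gives, with k' the index across e_ij,
     F_ijk = (1 - om_k) C(e,k) + om_k C(e,k')
   (the boundary coefficient replaces C(e,k') on a boundary edge).  Since splines
   are C^1, the blossoms of the two pieces along e_ij agree at (v_i, v_j, x) for
   all x, so the values x_k of B[S|_{t_i,j,k}](v_i, v_j, w_{ij,k}) satisfy the same
   linear system.  Its determinant 1 - om_k - om_k' does not vanish, because
   v_ijk <> v_ijk'; hence x_k = C(e,k), and x_k is the functional of the reduced
   space attached to C(e,k), whether or not the triangle is symmetric. *)

(* The functionals rest on choices: [piece] and [blossom] are picked by [xget]. They become
   computable only through two uniqueness facts, for the blossom of a cubic and for a cubic given on
   a nondegenerate triangle, and they are linear on splines rather than on all functions. Contact of
   order one across an edge controls only B(w,w,y) for w on the segment from v_i to v_ij. Polarizing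
   in w gives B(a,b,y) for two points a, b of that line, and v_j is reached because it lies on the
   same line. Differentiability is relative to the closed domain, so the gradient is compared with a
   blossom only for y in the triangle, and then for all y by affinity. Split points of two triangles
   differ because a common one would be interior to the intersection of the triangles, which is
   contained in a line. On a boundary edge the system is one equation with factor 1 - om_k, which is
   nonzero because the split point is not on the edge. *)
Require Import Defs.
From mathcomp Require Import all_boot all_order all_algebra.
From mathcomp Require Import all_classical all_reals all_analysis.
From mathcomp Require Import ring lra.
Import Order.TTheory GRing.Theory Num.Theory numFieldNormedType.Exports.
Local Open Scope classical_set_scope.
Local Open Scope ring_scope.

Set Implicit Arguments.
Unset Strict Implicit.
Unset Printing Implicit Defensive.

(** * Triangles in the plane *)

Section PlaneGeometry.
Variable R : realType.
Implicit Types (a b c p d x y z : plane R) (A : set (plane R)).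

Lemma plane_eqP x y :
  x ord0 0 = y ord0 0 -> x ord0 1 = y ord0 1 -> x = y.
Proof.
move=> h0 h1; apply/rowP => i; case: i => [[|[|//]] hi].
- by rewrite (_ : Ordinal hi = 0) //; apply/val_inj.
- by rewrite (_ : Ordinal hi = 1) //; apply/val_inj.
Qed.

(** Twice the signed area, as a determinant. *)
Definition triangle_area a b c : R :=
  (b ord0 0 - a ord0 0) * (c ord0 1 - a ord0 1)
  - (b ord0 1 - a ord0 1) * (c ord0 0 - a ord0 0).

Lemma collinear_area a b c : triangle_area a b c = 0 -> collinear a b c.
Proof.
rewrite /triangle_area => h.
have [eab|nab] := eqVneq a b.
  exists a, (c - a) => x [[->|->]|->].
  - by exists 0; rewrite scale0r addr0.
  - by exists 0; rewrite scale0r addr0 eab.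
  - by exists 1; rewrite scale1r addrC subrK.
exists a, (b - a) => x [[->|->]|->].
- by exists 0; rewrite scale0r addr0.
- by exists 1; rewrite scale1r addrC subrK.
(* The parameter of [c] on the line is read off a coordinate in which [b - a] is nonzero. *)
have [e0|n0] := eqVneq (b ord0 0 - a ord0 0) 0.
  have n1 : b ord0 1 - a ord0 1 != 0.
    apply: contra_neq nab => e1; apply: plane_eqP; lra.
  exists ((c ord0 1 - a ord0 1) / (b ord0 1 - a ord0 1)).
  apply: plane_eqP; rewrite !mxE; last by field.
  rewrite e0 mulr0 addr0.
  have /eqP : (b ord0 1 - a ord0 1) * (c ord0 0 - a ord0 0) = 0.
    by move: h; rewrite e0 mul0r sub0r => /eqP; rewrite oppr_eq0 => /eqP.
  by rewrite mulf_eq0 (negbTE n1) subr_eq0 => /eqP.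
exists ((c ord0 0 - a ord0 0) / (b ord0 0 - a ord0 0)).
apply: plane_eqP; rewrite !mxE; first by field.
apply/eqP; rewrite -subr_eq0 -(mulrI_eq0 _ (mulfI n0)); apply/eqP.
rewrite -[RHS]h; field; exact: n0.
Qed.

Lemma noncollinear_area a b c : ~ collinear a b c -> triangle_area a b c != 0.
Proof. by move=> h; apply/eqP => /collinear_area. Qed.

(** The area is affine in its third argument and vanishes at [a] and [b], so only the weight of [c]
    remains. *)
Lemma area_combE a b c (al be ga : R) : al + be + ga = 1 ->
  triangle_area a b (al *: a + be *: b + ga *: c) = ga * triangle_area a b c.
Proof.
move=> h; have -> : al = 1 - be - ga by lra.
by rewrite /triangle_area !mxE; ring.
Qed.

Definition barycentric_frame a b c : Prop := forall y, exists al be ga : R,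
  al + be + ga = 1 /\ y = al *: a + be *: b + ga *: c.

Lemma area_barycentric a b c :
  triangle_area a b c != 0 -> barycentric_frame a b c.
Proof.
move=> n0 y.
(* Cramer's rule: barycentric coordinates are ratios of areas. *)
exists (1 - triangle_area a y c / triangle_area a b c
          - triangle_area a b y / triangle_area a b c),
  (triangle_area a y c / triangle_area a b c),
  (triangle_area a b y / triangle_area a b c).
split; first by ring.
move: n0; rewrite /triangle_area => n0.
by apply: plane_eqP; rewrite !mxE; field.
Qed.

Definition triangle a b c : set (plane R) :=
  [set x | exists al be ga : R, [/\ 0 <= al, 0 <= be, 0 <= ga, al + be + ga = 1
     & x = al *: a + be *: b + ga *: c]].

Lemma hull_sub_triangle A a b c :
  A `<=` [set a; b; c] -> hull A `<=` triangle a b c.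
Proof.
move=> sA x [n [w [f [w0 w1 Af ->]]]].
(* [hull] allows combinations of any length. Letting the weights sum to [W] instead of 1 makes the
   property additive, so it passes through the big sum. *)
pose K (W : R) (z : plane R) := exists al be ga : R,
  [/\ 0 <= al, 0 <= be, 0 <= ga, al + be + ga = W
    & z = al *: a + be *: b + ga *: c].
suff : K (\sum_(m < n) w m) (\sum_(m < n) w m *: f m) by rewrite w1.
apply: (big_ind2 K).
- by exists 0, 0, 0; split=> //; rewrite ?scale0r ?addr0.
- move=> _ z _ z' [al [be [ga [h1 h2 h3 <- ->]]]] [al' [be' [ga' [h1' h2' h3' <- ->]]]].
  exists (al + al'), (be + be'), (ga + ga').
  split; rewrite ?addr_ge0 //; first by ring.
  by apply: plane_eqP; rewrite !mxE; ring.
- move=> m _; have := sA _ (Af m); case=> [[|]|] ->.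
  + by exists (w m), 0, 0; split; rewrite ?scale0r ?addr0.
  + by exists 0, (w m), 0; split; rewrite ?scale0r ?addr0 ?add0r.
  + by exists 0, 0, (w m); split; rewrite ?scale0r ?addr0 ?add0r.
Qed.

Lemma triangle_sub_hull A a b c :
  A a -> A b -> A c -> triangle a b c `<=` hull A.
Proof.
move=> Aa Ab Ac x [al [be [ga [h1 h2 h3 h ->]]]].
exists 3%N, (tnth [tuple al; be; ga]), (tnth [tuple a; b; c]); split.
- by case=> [[|[|[|//]]] ?].
- by rewrite !big_ord_recl big_ord0 !(tnth_nth 0) /= addr0 addrA.
- by case=> [[|[|[|//]]] ?].
- by rewrite !big_ord_recl big_ord0 !(tnth_nth 0) /= addr0 addrA.
Qed.

Lemma hull3E a b c : hull [set a; b; c] = triangle a b c.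
Proof.
rewrite eqEsubset; split; first exact: hull_sub_triangle.
by apply: triangle_sub_hull; [left; left|left; right|right].
Qed.

Lemma triangle_convex3 a b c x y z : triangle a b c x -> triangle a b c y ->
  triangle a b c z -> triangle x y z `<=` triangle a b c.
Proof.
move=> [x1 [x2 [x3 [x1p x2p x3p x1E ->]]]] [y1 [y2 [y3 [y1p y2p y3p y1E ->]]]].
move=> [z1 [z2 [z3 [z1p z2p z3p z1E ->]]]] _ [u [v [w [up vp wp uE ->]]]].
exists (u * x1 + v * y1 + w * z1), (u * x2 + v * y2 + w * z2),
  (u * x3 + v * y3 + w * z3); split; rewrite ?addr_ge0 ?mulr_ge0 //.
- transitivity (u * (x1 + x2 + x3) + v * (y1 + y2 + y3) + w * (z1 + z2 + z3));
    first by ring.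
  by rewrite x1E y1E z1E !mulr1.
- by apply: plane_eqP; rewrite !mxE; ring.
Qed.

Lemma triangle_segment a b c x y (s : R) : triangle a b c x ->
  triangle a b c y -> 0 <= s <= 1 ->
  triangle a b c ((1 - s) *: x + s *: y).
Proof.
move=> hx hy /andP[s0 s1]; apply: (triangle_convex3 hx hy hy).
exists (1 - s), s, 0; split; rewrite ?subr_ge0 //; first by ring.
by rewrite scale0r addr0.
Qed.

Lemma triangle_vertices a b c :
  [/\ triangle a b c a, triangle a b c b & triangle a b c c].
Proof.
by split; [exists 1, 0, 0|exists 0, 1, 0|exists 0, 0, 1]; split;
  rewrite ?scale0r ?scale1r ?addr0 ?add0r.
Qed.

Lemma interior_move A x d : interior A x -> exists2 s : R, 0 < s & A (x + s *: d).
Proof.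
move=> Ax.
have : (fun s : R => x + s *: d) s @[s --> (0 : R)] --> x + (0 : R) *: d.
  by apply: cvgD; [exact: cvg_cst|apply: cvgZr_tmp; exact: cvg_id].
rewrite scale0r addr0 => /(_ A Ax) /nbhs_ballP[e /= e0 he].
exists (e / 2); first by rewrite divr_gt0.
apply: he; rewrite /ball /= sub0r normrN gtr0_norm ?divr_gt0 //.
by rewrite ltr_pdivrMr // ltr_pMr // ltr1n.
Qed.

Lemma interior_line A p d x : (forall y, A y -> exists s : R, y = p + s *: d) ->
  ~ interior A x.
Proof.
move=> hA Ax; have [s xE] := hA _ (interior_subset Ax).
(* A direction that leaves the line: [d] turned by a right angle, or any nonzero vector if the line
   degenerates to a point. *)
pose d' : plane R := if d == 0 then const_mx (1 : R)
  else \row_j (if j == 0 then - d ord0 1 else d ord0 0).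
have [t t0 /hA[s']] := interior_move d' Ax.
rewrite xE /d' => {xE}; have [->|dn0] := eqVneq d 0.
  rewrite !scaler0 !addr0 => /rowP/(_ 0); rewrite !mxE mulr1 => ?; lra.
move=> /rowP h; have := h 0; have := h 1; rewrite !mxE /= => h1 h0.
have h2 : t * (d ord0 0 ^+ 2 + d ord0 1 ^+ 2) = 0.
  have e1 : t * d ord0 0 = (s' - s) * d ord0 1 by rewrite mulrBl; lra.
  have e0 : t * d ord0 1 = - (s' - s) * d ord0 0 by rewrite mulNr mulrBl; lra.
  rewrite mulrDr !expr2 !mulrA e1 e0; ring.
move/eqP: h2; rewrite mulf_eq0 (gt_eqF t0) /= paddr_eq0 ?sqr_ge0 //.
rewrite !sqrf_eq0 => /andP[/eqP d0 /eqP d1].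
by move/eqP: dn0; apply; apply: plane_eqP; rewrite !mxE.
Qed.

Lemma interior_triangle_area a b c x :
  triangle_area a b c != 0 -> interior (triangle a b c) x ->
  triangle_area a b x != 0.
Proof.
move=> n0 ix; apply/eqP => ax0.
(* Moving along [a - c] leads away from [c]: from a point of the line [ab], the weight of [c] would
   become [- s], which is negative. *)
have [s s0 [al [be [ga [_ _ ga0 sE xE]]]]] := interior_move (a - c) ix.
have : triangle_area a b (x + s *: (a - c)) = - s * triangle_area a b c.
  rewrite -[LHS]subr0 -[in X in _ - X]ax0 /triangle_area !mxE; ring.
rewrite xE area_combE // => /(mulIf n0) h; lra.
Qed.

End PlaneGeometry.

(** * Blossoms of cubic polynomials *)

Section Blossoms.
Variable R : realType.
Implicit Types (a b c x y z u v : plane R) (p : plane R -> R).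
Implicit Types (B : plane R -> plane R -> plane R -> R).

Lemma affine_fun_comb3 (f : plane R -> R) a b c (al be ga : R) :
  affine_fun f -> al + be + ga = 1 ->
  f (al *: a + be *: b + ga *: c) = al * f a + be * f b + ga * f c.
Proof.
move=> hf s1.
have fZ x (s : R) : f (s *: x) = f 0 + s * (f x - f 0).
  by have := hf 0 x s; rewrite scaler0 add0r => ->; ring.
have fD x y : f (x + y) = f x + f y - f 0.
  (* Seen as twice a midpoint, a sum comes within reach of affinity along lines. *)
  have -> : x + y = 2 *: ((1 - 2^-1) *: x + 2^-1 *: y).
    by apply: plane_eqP; rewrite !mxE; field.
  by rewrite fZ hf; field.
rewrite !fD !fZ; have -> : al = 1 - be - ga by lra.
by ring.
Qed.

Section BlossomTheory.
Variables (p : plane R -> R) (B : plane R -> plane R -> plane R -> R).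
Hypothesis hB : is_blossom p B.

Let sym12 x y z : B x y z = B y x z. Proof. by have [h _ _] := hB; case: (h x y z). Qed.
Let sym23 x y z : B x y z = B x z y. Proof. by have [h _ _] := hB; case: (h x y z). Qed.

Lemma blossom_comb3 x y a b c (al be ga : R) : al + be + ga = 1 ->
  B x y (al *: a + be *: b + ga *: c)
  = al * B x y a + be * B x y b + ga * B x y c.
Proof. by have [_ [_ _ h] _] := hB; exact: (affine_fun_comb3 _ _ _ (h x y)). Qed.

Lemma blossom_comb2 x y a b (s : R) :
  B x y ((1 - s) *: a + s *: b) = (1 - s) * B x y a + s * B x y b.
Proof. by have [_ [_ _ h] _] := hB; exact: h. Qed.

Lemma comb3_args a b c (al be ga : R) (w := al *: a + be *: b + ga *: c) :
  al + be + ga = 1 ->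
  [/\ forall u v, B w u v = al * B a u v + be * B b u v + ga * B c u v,
      forall u v, B u w v = al * B u a v + be * B u b v + ga * B u c v
    & forall u v, B u v w = al * B u v a + be * B u v b + ga * B u v c].
Proof.
have [_ [h1 h2 h3] _] := hB => h; split=> u v.
- exact: (affine_fun_comb3 _ _ _ (h1 u v) h).
- exact: (affine_fun_comb3 _ _ _ (h2 u v) h).
- exact: (affine_fun_comb3 _ _ _ (h3 u v) h).
Qed.

Lemma blossom_segment x y (s : R) :
  p ((1 - s) *: x + s *: y) = (1 - s) ^+ 3 * B x x x
    + 3 * s * (1 - s) ^+ 2 * B x x y + 3 * s ^+ 2 * (1 - s) * B x y y
    + s ^+ 3 * B y y y.
Proof.
have [_ _ <-] := hB; set w := _ + _.
have e3 u v : B u v w = (1 - s) * B u v x + s * B u v y by exact: blossom_comb2.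
have e2 u v : B u w v = (1 - s) * B u x v + s * B u y v.
  by rewrite sym23 e3 !(sym23 u v).
have e1 u v : B w u v = (1 - s) * B x u v + s * B y u v.
  by rewrite sym12 e2 !(sym12 u).
rewrite e3 !e2 !e1 (sym12 y x x) (sym23 x y x) (sym23 y y x) (sym12 y x y).
by ring.
Qed.

(** Bernstein form: the ordinates are blossom values at the vertices, and the factors 1, 3, 6 count
    the orderings of the arguments. *)
Lemma blossom_triangle a b c (al be ga : R) : al + be + ga = 1 ->
  p (al *: a + be *: b + ga *: c) =
    al ^+ 3 * B a a a + be ^+ 3 * B b b b + ga ^+ 3 * B c c c
    + 3 * al ^+ 2 * be * B a a b + 3 * al ^+ 2 * ga * B a a c
    + 3 * be ^+ 2 * al * B a b b + 3 * be ^+ 2 * ga * B b b c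
    + 3 * ga ^+ 2 * al * B a c c + 3 * ga ^+ 2 * be * B b c c
    + 6 * al * be * ga * B a b c.
Proof.
move=> h; have [_ _ <-] := hB; set w := _ + _.
have [e1 e2 e3] := comb3_args a b c h; rewrite -/w in e1 e2 e3.
rewrite e3 !e2 !e1.
rewrite !(sym12 b a) !(sym12 c a) !(sym12 c b) !(sym23 _ b a) !(sym23 _ c a).
rewrite !(sym23 _ c b) !(sym12 b a) !(sym12 c a) !(sym12 c b).
ring.
Qed.

(* The ten domain points with barycentric coordinates in {0, 1/3, 2/3, 1}
   determine the ten Bezier ordinates. *)
Lemma blossom_vanish a b c : barycentric_frame a b c ->
  (forall x, triangle a b c x -> p x = 0) -> forall x y z, B x y z = 0.
Proof.
move=> hf p0.
have ev (al be ga : R) (h : al + be + ga = 1) :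
    0 <= al -> 0 <= be -> 0 <= ga -> _ = 0 :=
  fun h1 h2 h3 => etrans (esym (blossom_triangle a b c h))
    (p0 _ (ex_intro _ al (ex_intro _ be (ex_intro _ ga
       (And5 h1 h2 h3 h erefl))))).
have t1 : 0 <= (1 / 3 : R) by lra.
have t2 : 0 <= (2 / 3 : R) by lra.
have h0 : 0 <= (0 : R) by []. have h1 : 0 <= (1 : R) by [].
have := ev 1 0 0 ltac:(lra) h1 h0 h0.
have := ev 0 1 0 ltac:(lra) h0 h1 h0.
have := ev 0 0 1 ltac:(lra) h0 h0 h1.
have := ev (2 / 3) (1 / 3) 0 ltac:(lra) t2 t1 h0.
have := ev (2 / 3) 0 (1 / 3) ltac:(lra) t2 h0 t1.
have := ev (1 / 3) (2 / 3) 0 ltac:(lra) t1 t2 h0.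
have := ev 0 (2 / 3) (1 / 3) ltac:(lra) h0 t2 t1.
have := ev (1 / 3) 0 (2 / 3) ltac:(lra) t1 h0 t2.
have := ev 0 (1 / 3) (2 / 3) ltac:(lra) h0 t1 t2.
have := ev (1 / 3) (1 / 3) (1 / 3) ltac:(lra) t1 t1 t1.
move=> {ev p0} eabc ebcc eacc ebbc eabb eaac eaab eccc ebbb eaaa.
have Baaa : B a a a = 0 by lra.
have Bbbb : B b b b = 0 by lra.
have Bccc : B c c c = 0 by lra.
have Baab : B a a b = 0 by lra.
have Baac : B a a c = 0 by lra.
have Babb : B a b b = 0 by lra.
have Bbbc : B b b c = 0 by lra.
have Bacc : B a c c = 0 by lra.
have Bbcc : B b c c = 0 by lra.
have Babc : B a b c = 0 by lra.
move=> x y z.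
have [x1 [x2 [x3 [xh ->]]]] := hf x.
have [y1 [y2 [y3 [yh ->]]]] := hf y.
have [z1 [z2 [z3 [zh ->]]]] := hf z.
have [e1 _ _] := comb3_args a b c xh.
have [_ e2 _] := comb3_args a b c yh.
have [_ _ e3] := comb3_args a b c zh.
rewrite e3 !e2 !e1.
rewrite !(sym12 b a) !(sym12 c a) !(sym12 c b) !(sym23 _ b a) !(sym23 _ c a).
rewrite !(sym23 _ c b) !(sym12 b a) !(sym12 c a) !(sym12 c b).
by rewrite Baaa Bbbb Bccc Baab Baac Babb Bbbc Bacc Bbcc Babc; ring.
Qed.

End BlossomTheory.

Lemma affine_fun_lin (f g : plane R -> R) (s : R) : affine_fun f ->
  affine_fun g -> affine_fun (fun x => s * f x + g x).
Proof. by move=> hf hg x y t; rewrite hf hg; ring. Qed.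

Lemma is_blossom_lin p p' B B' (s : R) : is_blossom p B -> is_blossom p' B' ->
  is_blossom (fun x => s * p x + p' x) (fun x y z => s * B x y z + B' x y z).
Proof.
move=> [S1 [A1 A2 A3] D1] [S2 [C1 C2 C3] D2]; split.
- move=> x y z; have [h1 h2] := S1 x y z; have [h1' h2'] := S2 x y z.
  by split; [rewrite h1 h1'|rewrite h2 h2'].
- by split=> *; exact: affine_fun_lin.
- by move=> x; rewrite D1 D2.
Qed.

Lemma standard_frame : barycentric_frame (R := R) 0 (delta_mx 0 0) (delta_mx 0 1).
Proof.
apply: area_barycentric; rewrite /triangle_area !mxE /= !subr0 mulr1 mulr0 subr0.
exact: oner_neq0.
Qed.

(** The difference is a blossom of the zero function, which vanishes on any reference triangle. *)
Lemma is_blossom_uniq p B B' : is_blossom p B -> is_blossom p B' ->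
  forall x y z, B x y z = B' x y z.
Proof.
move=> h h' x y z; have hd := is_blossom_lin (-1) h h'.
have z0 w : triangle 0 (delta_mx 0 0) (delta_mx 0 1) w -> -1 * p w + p w = 0.
  by rewrite mulN1r addNr.
have := blossom_vanish hd standard_frame z0 x y z; lra.
Qed.

Lemma blossom_is_blossom p : (exists B, is_blossom p B) ->
  is_blossom p (blossom p).
Proof. by case=> B hB; rewrite /blossom; case: xgetP => [b _ //|/(_ B)]. Qed.

Lemma blossomE p B : is_blossom p B -> blossom p = B.
Proof.
move=> h; apply/funext => x; apply/funext => y; apply/funext => z.
exact: is_blossom_uniq (blossom_is_blossom (ex_intro _ B h)) h x y z.
Qed.

Lemma affine_fun_cst (s : R) : affine_fun (fun _ : plane R => s).
Proof. by move=> x y t; ring. Qed.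

Lemma affine_fun_coord i : affine_fun (fun x : plane R => x ord0 i).
Proof. by move=> x y t; rewrite !mxE. Qed.

(** Polarization: average the product over the six assignments of the arguments to the factors. *)
Lemma product_has_blossom (f g h : plane R -> R) : affine_fun f ->
  affine_fun g -> affine_fun h ->
  exists B, is_blossom (fun x => f x * g x * h x) B.
Proof.
move=> hf hg hh.
exists (fun x y z => 6^-1 * (f x * g y * h z + f x * g z * h y + f y * g x * h z
  + f y * g z * h x + f z * g x * h y + f z * g y * h x)).
split; first by move=> x y z; split; ring.
- by split=> ? ? x y t; rewrite hf hg hh; ring.
- by move=> x; field.
Qed.

Lemma monomial_has_blossom (m n : nat) : (m + n < 4)%N ->
  exists B, is_blossom (fun x : plane R => x ord0 0 ^+ m * x ord0 1 ^+ n) B.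
Proof.
move=> h.
(* A monomial of lower degree is padded with constant factors 1 to a product of exactly three affine
   functions. *)
pose l k : plane R -> R := if (k < m)%N then fun x => x ord0 0
  else if (k < m + n)%N then fun x => x ord0 1 else fun=> 1.
have hl k : affine_fun (l k).
  rewrite /l; case: ifP => _; first exact: affine_fun_coord.
  by case: ifP => _; [exact: affine_fun_coord|exact: affine_fun_cst].
have [B hB] := product_has_blossom (hl 0) (hl 1) (hl 2).
exists B; suff -> : (fun x : plane R => x ord0 0 ^+ m * x ord0 1 ^+ n)
  = (fun x => l 0%N x * l 1%N x * l 2%N x) by [].
apply/funext => x; rewrite /l.
by case: m h {hl hB l} => [|[|[|[|m]]]] //; case: n => [|[|[|[|n]]]] //= _; ring.
Qed.

Lemma cubic_has_blossom p : cubic p -> exists B, is_blossom p B.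
Proof.
case=> Q [sQ pE].
have -> : p = fun x => \sum_(m <- mpoly.msupp Q)
    mpoly.mcoeff m Q * \prod_i x ord0 i ^+ m i.
  by apply/funext => x; rewrite pE mpoly.mevalE.
(* The induction runs over an arbitrary list of monomials with this degree bound, while the
   coefficients stay those of [Q]. *)
have : all (fun m => (mpoly.mdeg m < 4)%N) (mpoly.msupp Q).
  apply/allP => m /mpoly.msize_mdeg_lt h; exact: leq_trans h sQ.
elim: (mpoly.msupp Q) => [_|m s IH /= /andP[hm /IH[B hB]]].
  exists (fun _ _ _ => 0); split=> //; last by move=> x; rewrite big_nil.
  by split=> *; exact: affine_fun_cst.
have e1 : @lift 2 ord0 ord0 = 1 by apply/val_inj.
move: hm; rewrite mpoly.mdegE big_ord_recl big_ord1 e1 => /monomial_has_blossom[C hC].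
have := is_blossom_lin (mpoly.mcoeff m Q) hC hB.
set F := (X in is_blossom X); set B' := (X in is_blossom _ X) => h.
exists B'; congr is_blossom : h; apply/funext => x.
by rewrite /F big_cons big_ord_recl big_ord1 e1.
Qed.

Lemma cubic_lin p p' (s : R) : cubic p -> cubic p' ->
  cubic (fun x => s * p x + p' x).
Proof.
move=> [Q [sQ pE]] [Q' [sQ' pE']]; exists (s *: Q + Q'); split.
  apply: leq_trans (mpoly.msizeD_le _ _) _; rewrite geq_max sQ' andbT.
  exact: leq_trans (mpoly.msizeZ_le _ _) sQ.
by move=> x; rewrite mpoly.mevalD mpoly.mevalZ -pE -pE'.
Qed.

Lemma cubic_blossom p : cubic p -> is_blossom p (blossom p).
Proof. by move/cubic_has_blossom/blossom_is_blossom. Qed.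

Lemma blossom_lin p p' (s : R) x y z : cubic p -> cubic p' ->
  blossom (fun x => s * p x + p' x) x y z = s * blossom p x y z + blossom p' x y z.
Proof.
move=> /cubic_blossom h /cubic_blossom h'.
by rewrite (blossomE (is_blossom_lin s h h')).
Qed.

(** The difference has a blossom that vanishes identically, and its diagonal gives equality off the
    triangle too. *)
Lemma cubic_eq_on_triangle p p' a b c : cubic p -> cubic p' ->
  barycentric_frame a b c -> (forall x, triangle a b c x -> p x = p' x) ->
  p = p'.
Proof.
move=> /cubic_blossom h /cubic_blossom h' hf pp'; apply/funext => x.
have hd := is_blossom_lin (-1) h h'.
have z0 y : triangle a b c y -> -1 * p y + p' y = 0.
  by move=> /pp' ->; rewrite mulN1r addNr.
have := blossom_vanish hd hf z0 x x x.
by have [_ _ ->] := h; have [_ _ ->] := h'; lra.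
Qed.

End Blossoms.

(** * Gradients of splines and blossoms of their pieces *)

Section Gradient.
Variables (R : realType) (A : set (plane R)).

(** Open sets of the subtype are preimages of open sets of the plane, so a neighbourhood contains
    the trace of a ball. *)
Lemma near_set_type (x : A) (Q : set A) : nbhs x Q ->
  exists2 de : R, 0 < de & forall y : A, `|val y - val x| < de -> Q y.
Proof.
rewrite nbhsE /= => -[W [[U oU <-] xU] sub].
have : nbhs (val x) U by exact: open_nbhs_nbhs.
move=> /nbhs_normP[de /= de0 hde].
exists de => // y hy; apply: sub; apply: hde => /=.
by rewrite distrC.
Qed.

(* Along the segment from x to y the cubic expands as
   p (x + s (y - x)) = p x + 3 s (B x x y - B x x x) + O(s^2). *)
Lemma gradient_blossom (S : A -> R) (g : A -> plane R) (p : plane R -> R) B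
    (a b c : plane R) (x : A) (y : plane R) :
  (forall eps : R, 0 < eps -> \forall z \near x,
     `|S z - S x - \sum_(m < 2) g x ord0 m * (val z - val x) ord0 m|
       <= eps * `|val z - val x|) ->
  is_blossom p B -> triangle a b c `<=` A ->
  (forall z : A, triangle a b c (val z) -> S z = p (val z)) ->
  triangle a b c (val x) -> triangle a b c y ->
  3 * (B (val x) (val x) y - B (val x) (val x) (val x))
  = \sum_(m < 2) g x ord0 m * (y - val x) ord0 m.
Proof.
move=> hg hB sA hS hx hy; set G := RHS; set u := val x.
apply/eqP; rewrite -subr_eq0; set E : R := _ - _.
(* [K1] and [K2] are the coefficients of [s ^+ 2] and [s ^+ 3] of the cubic along the segment. [E]
   is the mismatch of the linear terms. *)
pose K1 := 3 * B u u u - 6 * B u u y + 3 * B u y y.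
pose K2 := - B u u u + 3 * B u u y - 3 * B u y y + B y y y.
apply/negPn/negP; rewrite -normr_gt0 => E0.
pose N := `|y - u| + 1.
have N0 : 0 < N by rewrite ltr_wpDl.
pose M : R := `|K1| + `|K2| + 1.
have M0 : 0 < M by rewrite ltr_wpDl // addr_ge0.
have eps0 : 0 < `|E| / (2 * N) by rewrite divr_gt0 // mulr_gt0.
have [de de0 hde] := near_set_type (hg _ eps0).
(* The three bounds keep the point on the segment, keep it within [de] of [x], and make the
   higher-order remainder, divided by [s], at most a quarter of [|E|]. The differentiability error
   divided by [s] is at most half of [|E|], so together they fall short of [|E|]. *)
pose s := Num.min (1 / 2) (Num.min (de / (2 * N)) (`|E| / (4 * M))).
have s0 : 0 < s by rewrite !lt_min !divr_gt0 // mulr_gt0.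
have s1 : s <= 1 / 2 by rewrite ge_min lexx.
have sde : s <= de / (2 * N) by rewrite /s !ge_min lexx /= orbT.
have sE : s <= `|E| / (4 * M) by rewrite /s !ge_min lexx !orbT.
have s01 : 0 <= s <= 1 by apply/andP; split; lra.
have hz : triangle a b c ((1 - s) *: u + s *: y) by exact: triangle_segment.
pose z : A := exist (fun z => z \in A) _ (mem_set (sA _ hz)).
have zu : val z - u = s *: (y - u).
  by rewrite /z /=; apply: plane_eqP; rewrite !mxE; ring.
have nzu : `|val z - u| = s * `|y - u| by rewrite zu normrZ gtr0_norm.
have yuN : `|y - u| <= N by rewrite lerDl.
have zde : `|val z - val x| < de.
  rewrite -/u nzu; apply: le_lt_trans (_ : _ <= s * N) _.
    by rewrite ler_pM2l.
  apply: le_lt_trans (_ : _ <= de / (2 * N) * N) _; first by rewrite ler_pM2r.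
  rewrite invfM mulrA mulrVK ?unitfE ?gt_eqF //; lra.
have := hde z zde; rewrite -/u nzu (hS z hz) (hS x hx).
have -> : \sum_(m < 2) g x ord0 m * (val z - u) ord0 m = s * G.
  by rewrite mulr_sumr; apply: eq_bigr => m _; rewrite zu !mxE; ring.
have -> : p (val z) - p (val x) - s * G = s * (E + s * (K1 + s * K2)).
  rewrite /z /= (blossom_segment hB) -/u; have [_ _ <-] := hB.
  by rewrite /E /K1 /K2; ring.
rewrite normrM gtr0_norm // mulrCA ler_pM2l // => h1.
have h2 : `|E| / (2 * N) * `|y - u| <= `|E| / 2.
  rewrite invfM mulrA -mulrA ger_pMr ?divr_gt0 //.
  by rewrite mulrC ler_pdivrMr // mul1r.
have h3 : `|s * (K1 + s * K2)| <= `|E| / 4.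
  rewrite normrM gtr0_norm //.
  have hK : `|K1 + s * K2| <= M.
    apply: le_trans (ler_normD _ _) _; rewrite normrM (gtr0_norm s0).
    have : s * `|K2| <= 1 * `|K2| by apply: ler_wpM2r => //; lra.
    rewrite /M; lra.
  apply: le_trans (_ : _ <= s * M) _; first by rewrite ler_pM2l.
  by rewrite -ler_pdivlMr // -mulrA -invfM.
have := ler_normB (E + s * (K1 + s * K2)) (s * (K1 + s * K2)).
rewrite addrK; lra.
Qed.

End Gradient.

(** * Splines on the Powell-Sabin refinement *)

Section Triangulation.
Variables (R : realType) (I : finType) (D : complex R I).
Hypothesis hD : is_triangulation D.

Lemma ixC12 (i j k : I) : [ix i; j; k] = [ix j; i; k].
Proof. by apply/setP => x; rewrite !inE (orbC (x == i)). Qed.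

Lemma ixC23 (i j k : I) : [ix i; j; k] = [ix i; k; j].
Proof. by apply/setP => x; rewrite !inE orbAC. Qed.

Lemma ixC (i j : I) : [ix i; j] = [ix j; i].
Proof. by apply/setP => x; rewrite !inE orbC. Qed.

Lemma tri_area i j k : [ix i; j; k] \in tris D ->
  triangle_area (pos D i) (pos D j) (pos D k) != 0.
Proof. by move=> h; apply/noncollinear_area/(tri_nondegenerate hD). Qed.

Lemma cell_triE i j k :
  cell D [ix i; j; k] = triangle (pos D i) (pos D j) (pos D k).
Proof.
rewrite eqEsubset; split.
  apply: hull_sub_triangle => x [l /=]; rewrite !inE.
  by move=> /orP[/orP[]|] /eqP -> <-; [left; left|left; right|right].
by apply: triangle_sub_hull; [exists i|exists j|exists k] => //=;
  rewrite !inE eqxx ?orbT.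
Qed.

Lemma cell_edge_line (i j : I) x : cell D [ix i; j] x ->
  exists s : R, x = pos D i + s *: (pos D j - pos D i).
Proof.
(* A segment is treated as a triangle with a repeated vertex. *)
move=> /(@hull_sub_triangle _ _ (pos D i) (pos D j) (pos D j)) [].
  move=> y [l /=]; rewrite !inE.
  by move=> /orP[] /eqP -> <-; [left; left|left; right].
move=> al [be [ga [_ _ _ h ->]]]; exists (be + ga).
by have -> : al = 1 - be - ga by [lra]; apply: plane_eqP; rewrite !mxE; ring.
Qed.

Lemma tri_distinct i j k : [ix i; j; k] \in tris D ->
  [/\ i != j, i != k & j != k].
Proof.
have n a b : [ix a; a; b] \notin tris D.
  by apply/negP => /(card_tri hD); rewrite finset.setUid cards2; case: (_ != _).
move=> h; split; apply/eqP => e; move: h; rewrite e.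
- by rewrite (negPf (n _ _)).
- by rewrite ixC23 (negPf (n _ _)).
- by rewrite ixC12 ixC23 (negPf (n _ _)).
Qed.

Variable P : split_points R I.
Hypothesis hP : is_ps_refinement D P.

Lemma split_point_area i j k : [ix i; j; k] \in tris D ->
  triangle_area (pos D i) (pos D j) (vT P [ix i; j; k]) != 0.
Proof.
move=> h; apply: (interior_triangle_area (tri_area h)).
by rewrite -cell_triE; exact: (vT_inside hP).
Qed.

Lemma vE_segment i j k : [ix i; j; k] \in tris D ->
  open_segment (pos D i) (pos D j) (vE P [ix i; j]).
Proof. by move=> h; apply: (vE_inside hP); exact: (side_is_edge hD h). Qed.

(** If v_ij divides the edge at parameter s > 0, replacing v_j by v_ij multiplies the nonzero area
    of v_i, v_j, v_ijk by s. *)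
Lemma ps_frame i j k : [ix i; j; k] \in tris D ->
  barycentric_frame (pos D i) (vE P [ix i; j]) (vT P [ix i; j; k]).
Proof.
move=> h; apply: area_barycentric.
have [s [/andP[s0 _] ->]] := vE_segment h.
have := split_point_area h; rewrite /triangle_area !mxE.
set a := (X in X != 0) => a0; set b := (X in X != 0).
have -> : b = s * a by rewrite /a /b; ring.
by rewrite mulf_neq0 // gt_eqF.
Qed.

Lemma ps_triE i j k :
  ps_tri D P i j k = triangle (pos D i) (vE P [ix i; j]) (vT P [ix i; j; k]).
Proof. exact: hull3E. Qed.

Lemma ps_tri_domain i j k : [ix i; j; k] \in tris D ->
  ps_tri D P i j k `<=` domain D.
Proof.
move=> h x; rewrite ps_triE => hx; exists [ix i; j; k] => //.
rewrite cell_triE; apply: triangle_convex3 hx.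
- by have [] := triangle_vertices (pos D i) (pos D j) (pos D k).
- have [s [/andP[s0 s1] ->]] := vE_segment h.
  have [hi hj _] := triangle_vertices (pos D i) (pos D j) (pos D k).
  by apply: triangle_segment => //; rewrite !ltW.
- by rewrite -cell_triE; apply: interior_subset; exact: (vT_inside hP).
Qed.

(** A common split point would be interior to the intersection of the two triangles, but that set is
    empty, a vertex or an edge. *)
Lemma split_points_neq t t' : t \in tris D -> t' \in tris D -> t != t' ->
  vT P t <> vT P t'.
Proof.
move=> ht ht' tt' vv.
have hv : interior (cell D t `&` cell D t') (vT P t).
  rewrite interiorI; split; first exact: (vT_inside hP).
  by rewrite vv; exact: (vT_inside hP).
have [h|[i h]|[e he h]] := tri_inter hD ht ht' tt'; rewrite h in hv.
- by have := interior_subset hv.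
- apply: (@interior_line _ _ (pos D i) 0) hv => y ->.
  by exists 0; rewrite scaler0 addr0.
- have /cards2P[i [j [_ eE]]] : #|e| == 2%N by apply/eqP/(card_edge hD he).
  apply: (@interior_line _ _ (pos D i) (pos D j - pos D i)) hv => y.
  by rewrite eE; exact: cell_edge_line.
Qed.

Definition piecewise_cubic (S : fct R D) : Prop :=
  forall i j k, [ix i; j; k] \in tris D -> exists2 p, cubic p &
    forall x : domain D, ps_tri D P i j k (val x) -> S x = p (val x).

(** Whatever cubic [xget] returns agrees with [p] on a nondegenerate triangle, hence everywhere. *)
Lemma pieceE (S : fct R D) p i j k : [ix i; j; k] \in tris D -> cubic p ->
  (forall x : domain D, ps_tri D P i j k (val x) -> S x = p (val x)) ->
  piece S (ps_tri D P i j k) = p.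
Proof.
move=> h hp Sp; rewrite /piece.
case: xgetP => [p' _ [hp' Sp']|/(_ p)]; last by case.
apply: (cubic_eq_on_triangle hp' hp (ps_frame h)) => x; rewrite -ps_triE => hx.
pose z : domain D := exist (fun z => z \in domain D) x
  (mem_set (ps_tri_domain h hx)).
by rewrite -[p' x](Sp' z) // -[p x](Sp z).
Qed.

Lemma bl_piece (S : fct R D) i j k : piecewise_cubic S ->
  [ix i; j; k] \in tris D -> exists p,
  [/\ cubic p, is_blossom p (bl P S i j k) &
    forall x : domain D, ps_tri D P i j k (val x) -> S x = p (val x)].
Proof.
move=> hS h; have [p hp Sp] := hS _ _ _ h; exists p; split => //.
by rewrite /bl (pieceE h hp Sp); exact: cubic_blossom.
Qed.

Lemma bl_lin (a : R) (S S' : fct R D) i j k x y z :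
  piecewise_cubic S -> piecewise_cubic S' -> [ix i; j; k] \in tris D ->
  bl P (a *: S + S') i j k x y z = a * bl P S i j k x y z + bl P S' i j k x y z.
Proof.
move=> hS hS' h; have [p hp Sp] := hS _ _ _ h; have [p' hp' Sp'] := hS' _ _ _ h.
rewrite /bl (pieceE h hp Sp) (pieceE h hp' Sp') -blossom_lin //.
rewrite (pieceE h (cubic_lin a hp hp')) // => u hu.
by rewrite -Sp // -Sp'.
Qed.

(* C^1 contact along a line forces the two blossoms to agree as soon as two
   of the arguments lie on that line. *)
Lemma bl_across_edge (S : fct R D) i j k k' x : spline P S ->
  [ix i; j; k] \in tris D -> [ix i; j; k'] \in tris D ->
  bl P S i j k (pos D i) (pos D j) x = bl P S i j k' (pos D i) (pos D j) x.
Proof.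
move=> [[g [_ hg]] hS] h h'.
have [p [_ hB Sp]] := bl_piece hS h; have [p' [_ hB' Sp']] := bl_piece hS h'.
set B := bl P S i j k in hB *; set B' := bl P S i j k' in hB' *.
set a := pos D i; set b := vE P [ix i; j].
set c := vT P [ix i; j; k]; set c' := vT P [ix i; j; k'].
rewrite ps_triE -/a -/b -/c in Sp; rewrite ps_triE -/a -/b -/c' in Sp'.
have sub : triangle a b c `<=` domain D by rewrite -ps_triE; exact: ps_tri_domain.
have sub' : triangle a b c' `<=` domain D by rewrite -ps_triE; exact: ps_tri_domain.
(* At a point [w] of the common half-edge both pieces have the value and the gradient of [S], which
   fix the affine map B(w,w,.). *)
have grad (s : R) : 0 <= s <= 1 ->
    let w := (1 - s) *: a + s *: b in forall y, B w w y = B' w w y.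
  move=> s01 w.
  have tw d : triangle a b d w.
    by have [? ? _] := triangle_vertices a b d; exact: triangle_segment.
  pose z : domain D := exist (fun z => z \in domain D) w (mem_set (sub _ (tw c))).
  have e0 : B w w w = B' w w w.
    have [_ _ ->] := hB; have [_ _ ->] := hB'.
    by rewrite -[p w](Sp z (tw c)) -[p' w](Sp' z (tw c')).
  (* The gradient formula is available at the three vertices. Both sides are affine in [y], so it
     extends to the whole plane. *)
  have onhull d q C : is_blossom q C -> triangle a b d `<=` domain D ->
      (forall x : domain D, triangle a b d (val x) -> S x = q (val x)) ->
      barycentric_frame a b d -> forall y,
      3 * (C w w y - C w w w) = \sum_(m < 2) g z ord0 m * (y - w) ord0 m.
    move=> hC sd Sq fr y; have [al [be [ga [s1 yE]]]] := fr y.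
    have [ha hb hd] := triangle_vertices a b d.
    have G v := @gradient_blossom R (domain D) S g q C a b d z v (hg z) hC sd Sq (tw d).
    have Ga := G _ ha; have Gb := G _ hb; have Gd := G _ hd.
    rewrite /= -/w in Ga Gb Gd.
    rewrite yE (blossom_comb3 hC) //.
    have -> : \sum_(m < 2) g z ord0 m * (al *: a + be *: b + ga *: d - w) ord0 m
      = al * (\sum_(m < 2) g z ord0 m * (a - w) ord0 m)
        + be * (\sum_(m < 2) g z ord0 m * (b - w) ord0 m)
        + ga * (\sum_(m < 2) g z ord0 m * (d - w) ord0 m).
      have -> : al = 1 - be - ga by lra.
      by rewrite !mulr_sumr -!big_split /=; apply: eq_bigr => m _; rewrite !mxE; ring.
    rewrite -Ga -Gb -Gd; have -> : al = 1 - be - ga by lra.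
    by ring.
  move=> y; have := onhull _ _ _ hB sub Sp (ps_frame h) y.
  have := onhull _ _ _ hB' sub' Sp' (ps_frame h') y.
  by move=> <-; rewrite e0; lra.
have haa y : B a a y = B' a a y.
  by have := grad 0 _ y; rewrite subr0 scale1r scale0r addr0; apply; rewrite lexx ler01.
have hbb y : B b b y = B' b b y.
  by have := grad 1 _ y; rewrite subrr scale1r scale0r add0r; apply; rewrite lexx ler01.
(* Polarization: the value at the midpoint of [a] and [b] reveals the mixed term once the two pure
   ones are known to agree. *)
have hab y : B a b y = B' a b y.
  have half : 0 <= (2^-1 : R) <= 1 by apply/andP; split; lra.
  have := grad _ half y; set w := _ + _.
  have expand C q : is_blossom q C ->
      C w w y = 4^-1 * C a a y + 2^-1 * C a b y + 4^-1 * C b b y.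
    move=> hC; have [sy _ _] := hC.
    have c2 u : C u w y = (1 - 2^-1) * C u a y + 2^-1 * C u b y.
      by rewrite (sy u w y).2 (blossom_comb2 hC) (sy u y a).2 (sy u y b).2.
    rewrite c2 (sy w a y).1 (sy w b y).1 !c2 (sy b a y).1; lra.
  by rewrite (expand _ _ hB) (expand _ _ hB') haa hbb; lra.
have [s [/andP[s0 _] bE]] := vE_segment h.
rewrite -/a -/b in bE.
(* v_j is extrapolated from v_i and v_ij, which carries the agreement from the half-edge to the full
   edge. *)
have jE : pos D j = (1 - s^-1) *: a + s^-1 *: b.
  by rewrite bE; apply: plane_eqP; rewrite !mxE; field; rewrite gt_eqF.
have expand C q : is_blossom q C ->
    C a (pos D j) x = (1 - s^-1) * C a a x + s^-1 * C a b x.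
  move=> hC; have [sy _ _] := hC.
  by rewrite (sy a (pos D j) x).2 jE (blossom_comb2 hC) (sy a x a).2 (sy a x b).2.
by rewrite (expand _ _ hB) (expand _ _ hB') haa hab.
Qed.

End Triangulation.

(** * Families with a dual family of functionals *)

Section LinearAlgebra.
Variables (R : realType) (V : lmodType R).
Implicit Types (A U : set V) (phi : V -> R).

(** The functionals come from choice operators and are linear only on a subspace. Its closure is
    bundled in, so that membership and value of a sum are obtained together. *)
Record linear_on U phi : Prop := LinearOn {
  linear_on0 : U 0;
  linear_on_closed : forall a u v, U u -> U v -> U (a *: u + v);
  linear_on_lin : forall a u v, U u -> U v ->
    phi (a *: u + v) = a * phi u + phi v }.

Lemma linear_on_comb U phi (T : Type) (r : seq T) (Q : pred T)
    (c : T -> R) (F : T -> V) : linear_on U phi ->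
  (forall i, Q i -> U (F i)) ->
  U (\sum_(i <- r | Q i) c i *: F i) /\
  phi (\sum_(i <- r | Q i) c i *: F i) = \sum_(i <- r | Q i) c i * phi (F i).
Proof.
move=> [U0 Ucl lin] UF; elim: r => [|x r [IU IE]].
  rewrite !big_nil; split=> //.
  by have := lin 1 0 0 U0 U0; rewrite scaler0 addr0; lra.
rewrite !big_cons; case: ifP => // Qx.
by split; [apply: Ucl => //; exact: UF|rewrite lin ?IE //; exact: UF].
Qed.

Lemma linear_on_sum U phi (T : Type) (r : seq T) (Q : pred T)
    (F : T -> V) : linear_on U phi ->
  (forall i, Q i -> U (F i)) ->
  U (\sum_(i <- r | Q i) F i) /\
  phi (\sum_(i <- r | Q i) F i) = \sum_(i <- r | Q i) phi (F i).
Proof.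
move=> hphi UF; have [] := linear_on_comb r (fun=> 1) hphi UF.
under eq_bigr do rewrite scale1r.
by under [in X in _ = X -> _]eq_bigr do rewrite mul1r.
Qed.

Lemma linear_onD U phi u v : linear_on U phi -> U u -> U v ->
  U (u + v) /\ phi (u + v) = phi u + phi v.
Proof.
move=> [_ cl lin] hu hv; have := lin 1 _ _ hu hv; have := cl 1 _ _ hu hv.
by rewrite scale1r mul1r.
Qed.

Lemma linear_onZ U phi a u : linear_on U phi -> U u ->
  U (a *: u) /\ phi (a *: u) = a * phi u.
Proof.
move=> [U0 cl lin] hu; have := lin a _ _ hu U0; have := cl a _ _ hu U0.
have := lin 1 0 0 U0 U0; rewrite scaler0 !addr0 => h cu ->; split=> //; lra.
Qed.

Lemma span0 A : Defs.span A 0.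
Proof. by exists 0%N, (fun=> 0), (fun=> 0); split=> [[]|] //; rewrite big_ord0. Qed.

Lemma span_closed A a u v :
  Defs.span A u -> Defs.span A v -> Defs.span A (a *: u + v).
Proof.
move=> [n [c [f [Af ->]]]] [n' [c' [f' [Af' ->]]]].
exists (n + n')%N,
  (fun m => match fintype.split m with inl i => a * c i | inr i => c' i end),
  (fun m => match fintype.split m with inl i => f i | inr i => f' i end).
split; first by move=> m; case: (fintype.split m).
rewrite big_split_ord /= scaler_sumr; congr (_ + _); apply: eq_bigr => i _.
  by rewrite (unsplitK (inl i)) scalerA.
by rewrite (unsplitK (inr i)).
Qed.

Lemma span_mem A u : A u -> Defs.span A u.
Proof.
by exists 1%N, (fun=> 1), (fun=> u); split=> //; rewrite big_ord1 scale1r.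
Qed.

Section DualFamily.
Variables (J : finType) (Q : pred J) (G : J -> V) (lam : J -> V -> R).
Variable A : set V.
Hypothesis A_sub : forall f, A f -> exists2 j, Q j & f = G j.
Hypothesis lamE : forall (c : J -> R) j, Q j ->
  lam j (\sum_(k | Q k) c k *: G k) = c j.

Lemma comb_family n (c : 'I_n -> R) (j : 'I_n -> J) : (forall m, Q (j m)) ->
  \sum_(m < n) c m *: G (j m)
  = \sum_(k | Q k) (\sum_(m | j m == k) c m) *: G k.
Proof.
move=> Qj; rewrite (partition_big j Q) //=; apply: eq_bigr => k _.
by rewrite scaler_suml; apply: eq_bigr => m /eqP ->.
Qed.

(** Each functional returns the coefficient at its own index. Injectivity of [f] makes the indices
    distinct, so no two coefficients are merged. *)
Lemma dual_family_indep : lin_indep A.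
Proof.
move=> n f finj Af c c0 m.
have /choice[j hj] : forall m, exists j, Q j /\ f m = G j.
  by move=> m'; have [j] := A_sub (Af m'); exists j.
have Qj m' : Q (j m') by have [] := hj m'.
have jinj : injective j.
  by move=> m1 m2 e; apply: finj; rewrite (hj m1).2 (hj m2).2 e.
(* [lam] is known only on combinations of the family, so 0 is presented as the one with zero
   coefficients. *)
have <- := lamE (fun=> 0) (Qj m).
have -> : \sum_(k | Q k) 0 *: G k = \sum_(m < n) c m *: f m :> V.
  by rewrite c0 big1 // => k _; rewrite scale0r.
under eq_bigr do rewrite (hj _).2.
rewrite comb_family // lamE //.
by rewrite (big_pred1 m) // => k; rewrite (inj_eq jinj).
Qed.

Lemma dual_family_expansion u : Defs.span A u ->
  u = \sum_(k | Q k) lam k u *: G k.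
Proof.
move=> [n [c [f [Af uE]]]].
have /choice[j hj] : forall m, exists j, Q j /\ f m = G j.
  by move=> m'; have [j] := A_sub (Af m'); exists j.
have {}uE : u = \sum_(k | Q k) (\sum_(m | j m == k) c m) *: G k.
  rewrite uE -comb_family; last by move=> m; have [] := hj m.
  by apply: eq_bigr => m _; rewrite (hj m).2.
rewrite [LHS]uE; apply: eq_bigr => k Qk; congr (_ *: _).
by rewrite [in RHS]uE lamE.
Qed.

End DualFamily.
End LinearAlgebra.

(** * Edges and attached triangles *)

Section Incidence.
Variables (R : realType) (I : finType) (D : complex R I).
Hypothesis hD : is_triangulation D.
Implicit Types (e t : {set I}) (i j k l : I).

Lemma tri_notin e l : e \in edges D -> e :|: [set l]%SET \in tris D -> l \notin e.
Proof.
move=> he /(card_tri hD) h; apply/negP => le; move: h.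
by rewrite (finset.setUidPl _) ?finset.sub1set // (card_edge hD).
Qed.

Lemma tri_setD1 t l : t \in tris D -> l \in t ->
  (t :\ l)%SET \in edges D.
Proof.
move=> ht lt.
have : #|(t :\ l)%SET| == 2%N.
  by have := card_tri hD ht; rewrite (cardsD1 l) lt add1n => -[->].
move=> /cards2P[i [j [_ e]]]; rewrite e; apply: (side_is_edge hD (k := l)).
by rewrite -e finset.setUC finset.setD1K.
Qed.

(** Attached triangles are encoded by their vertex opposite to [e], the index over which the
    combined functions sum. *)
Definition thirds e : {set I} := [set l | e :|: [set l] \in tris D]%SET.

(** Adding the opposite vertex to [e] is a bijection; it is injective because that vertex is not in
    [e]. *)
Lemma card_thirds e : e \in edges D -> #|thirds e| = #|attached D e|.
Proof.
move=> he.
have -> : attached D e = [set (e :|: [set l])%SET | l in thirds e]%SET.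
  apply/setP => t; apply/idP/imsetP => [|[l]]; rewrite !inE; last first.
    by move=> ? ->; rewrite finset.subsetUl andbT.
  move=> /andP[ht et].
  have /cards1P[l tl] : #|(t :\: e)%SET| == 1%N.
    by rewrite cardsD (finset.setIidPr et) (card_tri hD ht) (card_edge hD he).
  have tE : t = (e :|: [set l])%SET.
    rewrite -tl; apply/finset.setP => x; rewrite !inE.
    by have [/(fintype.subsetP et)|] := boolP (x \in e).
  by exists l => //; rewrite inE -tE.
rewrite card_in_imset // => l l'; rewrite !inE => hl hl' e_eq.
have : l \in (e :|: [set l'])%SET.
  by rewrite -e_eq !inE eqxx orbT.
by rewrite !inE (negPf (tri_notin he hl)) => /eqP.
Qed.

Lemma interior_thirds e k : e \in edges D -> e \notin bedges D ->
  k \in thirds e -> exists2 k', k != k' & thirds e = [set k; k']%SET.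
Proof.
move=> he hb hk; have := card_thirds he.
rewrite (interior_edge_tris hD he hb) => /eqP/cards2P[a [b [ab E]]].
move: hk; rewrite E !inE => /orP[] /eqP ->; first by exists b.
by exists a; rewrite 1?eq_sym // finset.setUC.
Qed.

Lemma bedge_edge e : e \in bedges D -> e \in edges D.
Proof. by rewrite inE => /andP[]. Qed.

Lemma boundary_thirds e k : e \in bedges D -> k \in thirds e ->
  thirds e = [set k]%SET.
Proof.
move=> hb hk; have := card_thirds (bedge_edge hb).
rewrite (boundary_edge_tris hD hb) => /eqP/cards1P[a E].
by move: hk; rewrite E inE => /eqP ->.
Qed.

(** Every edge lies in a triangle, so the [pick] inside [third] succeeds. *)
Lemma third_tri i j : [ix i; j] \in edges D -> [ix i; j; third D i j] \in tris D.
Proof.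
move=> he; rewrite /third; case: pickP => //= h.
have [t ht et] := edge_in_tri hD he.
have : #|thirds [ix i; j]| != 0%N.
  rewrite card_thirds // cards_eq0; apply/set0Pn; exists t.
  by rewrite inE ht.
rewrite cards_eq0 => /set0Pn[l]; rewrite inE => hl.
by have := h l; rewrite hl.
Qed.

Lemma third_boundary i j k : [ix i; j] \in bedges D ->
  [ix i; j; k] \in tris D -> third D i j = k.
Proof.
move=> hb hk; have hk' : k \in thirds [ix i; j] by rewrite inE.
have : third D i j \in thirds [ix i; j].
  by rewrite inE; exact/third_tri/bedge_edge.
by rewrite (boundary_thirds hb hk') inE => /eqP.
Qed.

Lemma ix2_eq (a b i j : I) : a != b ->
  ([ix a; b] == [ix i; j]) =
  ((i == a) && (j == b)) || ((i == b) && (j == a)).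
Proof.
move=> ab; apply/eqP/orP => [e|[] /andP[/eqP-> /eqP->] //]; last exact: ixC.
have h x : (x == a) || (x == b) = (x == i) || (x == j).
  by have : (x \in [ix a; b]) = (x \in [ix i; j]) by [rewrite e]; rewrite !inE.
have := h a; have := h b; have := h i; have := h j.
rewrite !eqxx !orbT /= => hj hi /esym hb /esym ha.
case/orP: hi => /eqP ei; [left|right]; rewrite ei eqxx /=.
  by move: hb; rewrite ei [b == a]eq_sym (negPf ab) eq_sym.
by move: ha; rewrite ei (negPf ab) eq_sym.
Qed.

End Incidence.

(** * The reduced space *)

Section ReducedSpace.
Variables (R : realType) (I : finType) (D : complex R I).
Hypothesis hD : is_triangulation D.
Variable P : split_points R I.
Hypothesis hP : is_ps_refinement D P.
Variable q : I -> 'I_3 -> plane R.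
Variable L : labelling I.
Hypothesis hL : is_labelling D L.
Variable B : dof I -> fct R D.
Hypothesis hB : is_dual_basis P q L B.
Variable om : {set I} -> I -> R.
Hypothesis hom : is_weights D P om.
Implicit Types (i j k l a b : I) (e t : {set I}) (phi : fct R D -> R).

(** Closure is inherited from the dual basis, whose span is the spline space. *)
Lemma spline_closed (a : R) (S S' : fct R D) :
  spline P S -> spline P S' -> spline P (a *: S + S').
Proof. by have [[_ <-] _] := hB; exact: span_closed. Qed.

Lemma spline0 : spline P (0 : fct R D).
Proof. by have [[_ <-] _] := hB; exact: span0. Qed.

Lemma spline_B d : dof_valid D d -> spline P (B d).
Proof. by have [[_ <-] _] := hB => hd; apply: span_mem; exists d. Qed.

Lemma bl_linear_on i j k x y z : [ix i; j; k] \in tris D ->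
  linear_on (spline P) (fun S : fct R D => bl P S i j k x y z).
Proof.
move=> h; split; [exact: spline0|exact: spline_closed|].
by move=> a u v [_ hu] [_ hv]; exact: (bl_lin hD hP).
Qed.

Lemma beta_linear_on d : dof_valid D d ->
  linear_on (spline P) (fun S : fct R D => beta P q L d S).
Proof.
case: d => [i r|i j k|i j] /= h; apply: bl_linear_on => //.
- exact: labV_tri hL _.
- exact/third_tri/bedge_edge.
Qed.

Lemma beta_B d d' : dof_valid D d -> dof_valid D d' -> d' <> d ->
  beta P q L d' (B d) = 0.
Proof. by move=> hd hd'; have [_] := hB.2 d hd; exact. Qed.

Lemma betaF_DT i j k a b l :
  [ix i; j; k] \in tris D -> [ix a; b; l] \in tris D ->
  betaF P (B (DT a b l)) i j k = [&& i == a, j == b & k == l]%:R.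
Proof.
move=> h h'; rewrite -[LHS]/(beta P q L (DT i j k) (B (DT a b l))).
have [/and3P[/eqP-> /eqP-> /eqP->]|nn] := boolP [&& _, _ & _].
  by have [] := hB.2 (DT a b l) h'.
by apply: beta_B => // -[e1 e2 e3]; rewrite e1 e2 e3 !eqxx in nn.
Qed.

Lemma betaB_DE i j a b : [ix i; j] \in bedges D -> [ix a; b] \in bedges D ->
  betaB P (B (DE a b)) i j = ((i == a) && (j == b))%:R.
Proof.
move=> h h'; rewrite -[LHS]/(beta P q L (DE i j) (B (DE a b))).
have [/andP[/eqP-> /eqP->]|nn] := boolP (_ && _).
  by have [] := hB.2 (DE a b) h'.
by apply: beta_B => // -[e1 e2]; rewrite e1 e2 !eqxx in nn.
Qed.

Lemma betaV_DV i r j s : betaV P q L (B (DV j s)) i r = ((i == j) && (r == s))%:R.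
Proof.
rewrite -[LHS]/(beta P q L (DV i r) (B (DV j s))).
have [/andP[/eqP-> /eqP->]|nn] := boolP (_ && _).
  by have [] := hB.2 (DV j s) Logic.I.
by apply: beta_B => // -[e1 e2]; rewrite e1 e2 !eqxx in nn.
Qed.

(** The coefficient of B^t_{i,j,k} in B^e_{ij,l}. On an interior edge this is a 2 by 2 matrix with
    determinant 1 - om_k - om_k'. *)
Definition weight e l k : R := if k == l then 1 - om e l else om e k.

Lemma BEF_weight i j l : [ix i; j; l] \in tris D ->
  BEF B om i j l = \sum_(k | [ix i; j; k] \in tris D)
    weight [ix i; j] l k *: (B (DT i j k) + B (DT j i k)).
Proof.
move=> h; rewrite /BEF [RHS](bigD1 l) //= /weight eqxx; congr (_ + _).
by apply: eq_bigr => k /andP[_ /negPf ->].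
Qed.

Lemma BEF_sym i j l : BEF B om i j l = BEF B om j i l.
Proof.
rewrite /BEF (ixC j i) [B (DT j i l) + _]addrC; congr (_ + _).
by apply: eq_bigr => k _; rewrite [B (DT j i k) + _]addrC.
Qed.

Lemma BEB_sym i j : [ix i; j] \in bedges D -> BEB B om i j = BEB B om j i.
Proof.
move=> h; have e : third D j i = third D i j.
  apply: (third_boundary hD); first by rewrite ixC.
  by rewrite ixC12; exact/third_tri/bedge_edge.
by rewrite /BEB e (ixC j i) [B (DE j i) + _]addrC [B (DT j i _) + _]addrC.
Qed.

Lemma DT_pair_eval phi i j k : linear_on (spline P) phi ->
  [ix i; j; k] \in tris D ->
  spline P (B (DT i j k) + B (DT j i k)) /\
  phi (B (DT i j k) + B (DT j i k)) = phi (B (DT i j k)) + phi (B (DT j i k)).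
Proof.
move=> hphi h; apply: linear_onD => //; apply: spline_B => //=.
by rewrite ixC12.
Qed.

Lemma BEF_eval phi i j l : linear_on (spline P) phi ->
  [ix i; j; l] \in tris D ->
  spline P (BEF B om i j l) /\
  phi (BEF B om i j l) = \sum_(k | [ix i; j; k] \in tris D)
    weight [ix i; j] l k * (phi (B (DT i j k)) + phi (B (DT j i k))).
Proof.
move=> hphi h; rewrite BEF_weight //.
have [s1 ->] := @linear_on_comb _ _ _ _ _ (index_enum I)
  (fun k => [ix i; j; k] \in tris D) (weight [ix i; j] l)
  (fun k => B (DT i j k) + B (DT j i k)) hphi
  (fun k hk => (DT_pair_eval hphi hk).1).
by split=> //; apply: eq_bigr => k hk; have [_ ->] := DT_pair_eval hphi hk.
Qed.

Lemma BEB_eval phi i j : linear_on (spline P) phi -> [ix i; j] \in bedges D ->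
  spline P (BEB B om i j) /\
  phi (BEB B om i j) = phi (B (DE i j)) + phi (B (DE j i)) +
    om [ix i; j] (third D i j) *
      (phi (B (DT i j (third D i j))) + phi (B (DT j i (third D i j)))).
Proof.
move=> hphi h; rewrite /BEB; set k := third D i j.
have hk : [ix i; j; k] \in tris D by exact/third_tri/bedge_edge.
have [s1 <-] := DT_pair_eval hphi hk.
have [s2 <-] := linear_onZ (om [ix i; j] k) hphi s1.
have [s3 <-] : spline P (B (DE i j) + B (DE j i)) /\
    phi (B (DE i j) + B (DE j i)) = phi (B (DE i j)) + phi (B (DE j i)).
  by apply: linear_onD => //; apply: spline_B => //=; rewrite ixC.
exact: linear_onD.
Qed.

(** Indexed by the unordered edge; by [BEF_sym] the orientation chosen by [labE] does not affect the
    function. *)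
Definition BEFe e l := BEF B om (labE L e).1 (labE L e).2 l.
Definition BEBe e := BEB B om (labE L e).1 (labE L e).2.

Lemma labE_neq e : e \in edges D -> (labE L e).1 != (labE L e).2.
Proof.
move=> he; apply/eqP => e12; have := card_edge hD he.
by rewrite (labE_edge hL he) e12 finset.setUid cards1.
Qed.

Lemma labE_cases i j : [ix i; j] \in edges D ->
  (labE L [ix i; j]).1 = i /\ (labE L [ix i; j]).2 = j \/
  (labE L [ix i; j]).1 = j /\ (labE L [ix i; j]).2 = i.
Proof.
move=> h; have := labE_neq h; have := labE_edge hL h => /esym/eqP.
move=> + n; rewrite ix2_eq // => /orP[] /andP[/eqP <- /eqP <-]; by [left|right].
Qed.

Lemma BEF_edge i j l : [ix i; j] \in edges D ->
  BEF B om i j l = BEFe [ix i; j] l.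
Proof.
by rewrite /BEFe => /labE_cases-[] [-> ->] //; exact: BEF_sym.
Qed.

Lemma BEB_edge i j : [ix i; j] \in bedges D -> BEB B om i j = BEBe [ix i; j].
Proof.
move=> h; rewrite /BEBe.
by case: (labE_cases (bedge_edge h)) => -[-> ->]; rewrite // BEB_sym.
Qed.

(** * Regrouping an expansion by edges *)

Lemma tri_sides i j k : [ix i; j; k] \in tris D ->
  [/\ ([ix i; j; k] :\ k)%SET = [ix i; j], ([ix i; j; k] :\ i)%SET = [ix j; k]
    & ([ix i; j; k] :\ j)%SET = [ix k; i]].
Proof.
move=> /(tri_distinct hD) [ij ik jk].
split; apply/finset.setP => x; rewrite !inE.
- have [->|] := eqVneq x k => //=; last by rewrite orbF.
  by rewrite [k == i]eq_sym [k == j]eq_sym (negPf ik) (negPf jk).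
- have [->|] := eqVneq x i => //=.
  by rewrite (negPf ij) (negPf ik).
- have [->|] := eqVneq x j => //=; first by rewrite (negPf jk) eq_sym (negPf ij).
  by rewrite orbF orbC.
Qed.

(** A form free of labels: each vertex is paired with its opposite side, which makes the sum fit for
    reindexing. *)
Lemma BTT_sum i j k : [ix i; j; k] \in tris D ->
  BTT B om i j k = \sum_(l in [ix i; j; k]) BEFe ([ix i; j; k] :\ l)%SET l.
Proof.
move=> h; have [ij ik jk] := tri_distinct hD h; have [sk si sj] := tri_sides h.
rewrite (big_setD1 k) ?sk /=; last by rewrite !inE eqxx orbT.
rewrite big_setU1 /= ?inE // big_set1 si sj /BTT !BEF_edge ?addrA //.
- by rewrite -sj; apply: tri_setD1 => //; rewrite !inE eqxx orbT.
- by rewrite -si; apply: tri_setD1 => //; rewrite !inE eqxx.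
- exact: (side_is_edge hD h).
Qed.

Lemma symtris_tris t : t \in symtris D P -> t \in tris D.
Proof. by rewrite inE => /andP[]. Qed.

(** Double counting: a triangle with a marked vertex is the same as an edge with an opposite
    vertex. *)
Lemma sum_symtris (F : {set I} -> I -> fct R D) :
  \sum_(t in symtris D P) \sum_(l in t) F (t :\ l)%SET l =
  \sum_(e in edges D) \sum_(l | e :|: [set l]%SET \in symtris D P) F e l.
Proof.
rewrite !pair_big_dep /=.
rewrite [RHS](reindex_onto (fun p : {set I} * I => ((p.1 :\ p.2)%SET, p.2))
  (fun p : {set I} * I => (p.1 :|: [set p.2]%SET, p.2))) /=; last first.
  move=> [e l] /andP[/= he hl]; have nl := tri_notin hD he (symtris_tris hl).
  by rewrite finset.setUC setU1K.
apply: eq_bigl => -[t l] /=; rewrite xpair_eqE eqxx andbT.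
apply/andP/andP => [[ht lt]|[/andP[_]]].
  rewrite finset.setUC finset.setD1K // (tri_setD1 hD) ?eqxx ?ht //.
  exact: symtris_tris.
by move=> + /eqP e; rewrite e => ?; split=> //; rewrite -e !inE eqxx orbT.
Qed.

(** The C(e,k) of the overview. *)
Definition merged (cT : {set I} -> R) (cEF : {set I} -> I -> R) e l : R :=
  if e :|: [set l]%SET \in symtris D P then cT (e :|: [set l]%SET) else cEF e l.

Definition edge_expansion (cV : I -> 'I_3 -> R) (C : {set I} -> I -> R)
    (cE : {set I} -> R) : fct R D :=
  \sum_i \sum_(r < 3) cV i r *: B (DV i r)
  + \sum_(e in edges D) \sum_(l in thirds D e) C e l *: BEFe e l
  + \sum_(e in bedges D) cE e *: BEBe e.

(** The coefficient of a symmetric triangle is spread over its three sides. These pairs of edge and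
    vertex complement those of the other triangles. *)
Lemma expansionE cV cT cEF cE : expansion P L B om cV cT cEF cE =
  edge_expansion cV (merged cT cEF) cE.
Proof.
rewrite /expansion /edge_expansion -/BEFe -/BEBe; congr (_ + _); rewrite -addrA.
congr (_ + _).
have -> : \sum_(t in symtris D P)
    cT t *: BTT B om (labT L t).1.1 (labT L t).1.2 (labT L t).2 =
  \sum_(t in symtris D P) \sum_(l in t)
    cT ((t :\ l) :|: [set l])%SET *: BEFe (t :\ l)%SET l.
  apply: eq_bigr => t /symtris_tris ht; have tE := labT_tri hL ht.
  rewrite BTT_sum -?tE // scaler_sumr; apply: eq_bigr => l lt.
  by rewrite (finset.setUC (t :\ l)%SET) finset.setD1K.
rewrite (sum_symtris (fun e l => cT (e :|: [set l])%SET *: BEFe e l)).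
rewrite -big_split /=; apply: eq_bigr => e he.
rewrite [RHS](bigID (fun l => e :|: [set l]%SET \in symtris D P)) /=.
congr (_ + _).
  apply: eq_big => [l|l hl]; last by rewrite /merged hl.
  by rewrite [l \in _]inE andb_idl // => /symtris_tris.
apply: eq_big => [l|l]; first by rewrite [l \in thirds _ _]inE inE andbC.
by rewrite inE /merged => /andP[/negPf ->].
Qed.

(** * Values of the functionals on the combined functions *)

Lemma labE_tri e l : e \in edges D -> l \in thirds D e ->
  [ix (labE L e).1; (labE L e).2; l] \in tris D.
Proof. by move=> he; rewrite inE -(labE_edge hL he). Qed.

Lemma BEFe_eval phi e l : linear_on (spline P) phi -> e \in edges D ->
  l \in thirds D e -> let a := (labE L e).1 in let b := (labE L e).2 in
  spline P (BEFe e l) /\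
  phi (BEFe e l) = \sum_(k in thirds D e)
    weight e l k * (phi (B (DT a b k)) + phi (B (DT b a k))).
Proof.
move=> hphi he hl a b.
have [s ->] := BEF_eval hphi (labE_tri he hl); split=> //.
by rewrite -(labE_edge hL he); apply: eq_bigl => k; rewrite inE.
Qed.

Lemma BEBe_eval phi e : linear_on (spline P) phi -> e \in bedges D ->
  let a := (labE L e).1 in let b := (labE L e).2 in let k := third D a b in
  spline P (BEBe e) /\
  phi (BEBe e) = phi (B (DE a b)) + phi (B (DE b a)) +
    om e k * (phi (B (DT a b k)) + phi (B (DT b a k))).
Proof.
move=> hphi he a b k; have eE := labE_edge hL (bedge_edge he).
have [|s ->] := BEB_eval hphi (i := a) (j := b); first by rewrite -eE.
by rewrite -eE.
Qed.

(** Stated for any [phi] so that the vertex, triangle and boundary functionals share one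
    computation. *)
Lemma edge_expansion_eval phi cV C cE : linear_on (spline P) phi ->
  spline P (edge_expansion cV C cE) /\
  phi (edge_expansion cV C cE) =
  \sum_i \sum_(r < 3) cV i r * phi (B (DV i r))
  + \sum_(e in edges D) \sum_(l in thirds D e) C e l * phi (BEFe e l)
  + \sum_(e in bedges D) cE e * phi (BEBe e).
Proof.
move=> hphi; rewrite /edge_expansion.
have hV i : _ := @linear_on_comb _ _ _ _ _ (index_enum 'I_3) predT (cV i)
  (fun r => B (DV i r)) hphi (fun r _ => @spline_B (DV i r) Logic.I).
have [sV eV] := @linear_on_sum _ _ _ _ _ (index_enum I) predT
  (fun i => \sum_(r < 3) cV i r *: B (DV i r)) hphi (fun i _ => (hV i).1).
have hF e (he : e \in edges D) : _ :=
  @linear_on_comb _ _ _ _ _ (index_enum I) (fun l => l \in thirds D e) (C e)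
  (BEFe e) hphi (fun l hl => (BEFe_eval hphi he hl).1).
have [sF eF] := @linear_on_sum _ _ _ _ _ (index_enum {set I})
  (fun e => e \in edges D)
  (fun e => \sum_(l in thirds D e) C e l *: BEFe e l) hphi
  (fun e he => (hF e he).1).
have [sB eB] := @linear_on_comb _ _ _ _ _ (index_enum {set I})
  (fun e => e \in bedges D) cE
  (BEBe) hphi (fun e he => (BEBe_eval hphi he).1).
have [sVF eVF] := linear_onD hphi sV sF.
have [s ->] := linear_onD hphi sVF sB; split=> //.
rewrite eVF eV eF eB; congr (_ + _ + _).
  by apply: eq_bigr => i _; rewrite (hV i).2.
by apply: eq_bigr => e he; rewrite (hF e he).2.
Qed.

(** At most one orientation of the pair can match, so a functional with ordered indices sees the
    unordered edge. *)
Lemma ordered_pair_indicator a b i j (z : bool) : a != b ->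
  [&& i == a, j == b & z]%:R + [&& i == b, j == a & z]%:R =
  (([ix a; b] == [ix i; j]) && z)%:R :> R.
Proof.
move=> ab; rewrite ix2_eq //; have [->|ia] := eqVneq i a.
  by rewrite (negPf ab) /= orbF addr0.
by rewrite /= add0r andbA.
Qed.

Lemma betaF_DT_pair e i j k l : e \in edges D -> l \in thirds D e ->
  [ix i; j; k] \in tris D ->
  betaF P (B (DT (labE L e).1 (labE L e).2 l)) i j k +
  betaF P (B (DT (labE L e).2 (labE L e).1 l)) i j k =
  ((e == [ix i; j]) && (k == l))%:R.
Proof.
move=> he hl h; have hl' := labE_tri he hl.
rewrite !betaF_DT //; last by rewrite ixC12.
by rewrite ordered_pair_indicator ?(labE_neq he) // -(labE_edge hL he).
Qed.

Lemma betaF_BEFe e l i j k : e \in edges D -> l \in thirds D e ->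
  [ix i; j; k] \in tris D ->
  betaF P (BEFe e l) i j k = (e == [ix i; j])%:R * weight e l k.
Proof.
move=> he hl h; have hlin := @beta_linear_on (DT i j k) h.
rewrite -[LHS]/(beta P q L (DT i j k) _) (BEFe_eval hlin he hl).2 /=.
have [eE|ne] := eqVneq e [ix i; j].
  rewrite (bigD1 k) /=; last by rewrite eE inE.
  rewrite betaF_DT_pair // ?eE ?inE // -eE !eqxx /= mulr1 mul1r big1 ?addr0 //.
  move=> m /andP[hm /negPf mk]; rewrite betaF_DT_pair //.
  by rewrite [k == m]eq_sym mk andbF mulr0.
rewrite mul0r big1 // => m hm.
by rewrite betaF_DT_pair // (negPf ne) mulr0.
Qed.

Lemma betaF_BEBe e i j k : e \in bedges D -> [ix i; j; k] \in tris D ->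
  betaF P (BEBe e) i j k = (e == [ix i; j])%:R * om e k.
Proof.
move=> he h; have hlin := @beta_linear_on (DT i j k) h.
have ee := bedge_edge he; have eE := labE_edge hL ee.
have he' : [ix (labE L e).1; (labE L e).2] \in bedges D by rewrite -eE.
rewrite -[LHS]/(beta P q L (DT i j k) _) (BEBe_eval hlin he).2.
rewrite !(@beta_B (DE _ _)) //=; last by rewrite ixC.
have h3 : third D (labE L e).1 (labE L e).2 \in thirds D e.
  by rewrite [X in thirds _ X]eE inE; exact/third_tri/bedge_edge.
rewrite !add0r betaF_DT_pair //.
have [E|ne] := eqVneq e [ix i; j]; last by rewrite mulr0 mul0r.
have hk : k \in thirds D e by rewrite E inE.
move: h3; rewrite (boundary_thirds hD he hk) inE => /eqP ->.
by rewrite eqxx mulr1 mul1r.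
Qed.

Lemma betaB_BEFe e l i j : e \in edges D -> l \in thirds D e ->
  [ix i; j] \in bedges D -> betaB P (BEFe e l) i j = 0.
Proof.
move=> he hl h; have hlin := @beta_linear_on (DE i j) h.
rewrite -[LHS]/(beta P q L (DE i j) _) (BEFe_eval hlin he hl).2 big1 // => k hk.
have hk' := labE_tri he hk.
by rewrite !beta_B ?addr0 ?mulr0 //= ixC12.
Qed.

Lemma betaB_BEBe e i j : e \in bedges D -> [ix i; j] \in bedges D ->
  betaB P (BEBe e) i j = (e == [ix i; j])%:R.
Proof.
move=> he h; have hlin := @beta_linear_on (DE i j) h.
have ee := bedge_edge he; have eE := labE_edge hL ee.
have he' : [ix (labE L e).1; (labE L e).2] \in bedges D by rewrite -eE.
have he'' : [ix (labE L e).2; (labE L e).1] \in bedges D by rewrite ixC.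
have h3 := third_tri hD (bedge_edge he').
rewrite -[LHS]/(beta P q L (DE i j) _) (BEBe_eval hlin he).2.
rewrite (@beta_B (DT _ _ _)) // (@beta_B (DT _ _ _)) //=; last first.
  by rewrite ixC12.
rewrite addr0 mulr0 addr0 !betaB_DE //.
have := ordered_pair_indicator i j true (labE_neq ee).
by rewrite !andbT -eE.
Qed.

Lemma betaV_BEFe e l i r : e \in edges D -> l \in thirds D e ->
  betaV P q L (BEFe e l) i r = 0.
Proof.
move=> he hl; have hlin := @beta_linear_on (DV i r) Logic.I.
rewrite -[LHS]/(beta P q L (DV i r) _) (BEFe_eval hlin he hl).2 big1 // => k hk.
have hk' := labE_tri he hk.
by rewrite !beta_B ?addr0 ?mulr0 //= ixC12.
Qed.

Lemma betaV_BEBe e i r : e \in bedges D -> betaV P q L (BEBe e) i r = 0.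
Proof.
move=> he; have hlin := @beta_linear_on (DV i r) Logic.I.
have ee := bedge_edge he; have eE := labE_edge hL ee.
have he' : [ix (labE L e).1; (labE L e).2] \in bedges D by rewrite -eE.
have he'' : [ix (labE L e).2; (labE L e).1] \in bedges D by rewrite ixC.
have h3 := third_tri hD (bedge_edge he').
rewrite -[LHS]/(beta P q L (DV i r) _) (BEBe_eval hlin he).2.
by rewrite !beta_B ?addr0 ?mulr0 ?addr0 //= ixC12.
Qed.

(** * Recovering the coefficients of an expansion *)

Section Coefficients.
Variables (cV : I -> 'I_3 -> R) (C : {set I} -> I -> R) (cE : {set I} -> R).
Let S := edge_expansion cV C cE.

Lemma betaV_expansion i r : betaV P q L S i r = cV i r.
Proof.
have hlin := @beta_linear_on (DV i r) Logic.I.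
rewrite -[LHS]/(beta P q L (DV i r) _) (edge_expansion_eval cV C cE hlin).2 /=.
rewrite [X in _ + X + _]big1 => [|e he]; last first.
  by rewrite big1 // => l hl; rewrite betaV_BEFe // mulr0.
rewrite [X in _ + _ + X]big1 ?addr0 => [|e he]; last by rewrite betaV_BEBe // mulr0.
rewrite (bigD1 i) //= (bigD1 r) //= betaV_DV !eqxx mulr1 big1 ?addr0.
  rewrite big1 ?addr0 // => j /negPf ji; rewrite big1 // => s _.
  by rewrite betaV_DV [i == j]eq_sym ji mulr0.
by move=> s /negPf sr; rewrite betaV_DV [r == s]eq_sym sr andbF mulr0.
Qed.

Lemma betaB_expansion i j : [ix i; j] \in bedges D ->
  betaB P S i j = cE [ix i; j].
Proof.
move=> h; have hlin := @beta_linear_on (DE i j) h.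
rewrite -[LHS]/(beta P q L (DE i j) _) (edge_expansion_eval cV C cE hlin).2.
rewrite [X in X + _ + _]big1 => [|a _]; last first.
  by rewrite big1 // => r _; rewrite beta_B // mulr0.
rewrite [X in _ + X + _]big1 => [|e he]; last first.
  by rewrite big1 // => l hl; rewrite /= betaB_BEFe // mulr0.
rewrite !add0r (bigD1 [ix i; j]) //= betaB_BEBe // eqxx mulr1 big1 ?addr0 //.
by move=> e /andP[he /negPf ne]; rewrite betaB_BEBe // ne mulr0.
Qed.

(** Among the functions of the expansion, only those attached to the edge e_ij contain B^t_{i,j,k}.
    This is one row of the linear system. *)
Lemma betaF_expansion i j k : [ix i; j; k] \in tris D ->
  betaF P S i j k =
  \sum_(l in thirds D [ix i; j]) C [ix i; j] l * weight [ix i; j] l k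
  + (if [ix i; j] \in bedges D then cE [ix i; j] * om [ix i; j] k else 0).
Proof.
move=> h; have hlin := @beta_linear_on (DT i j k) h.
rewrite -[LHS]/(beta P q L (DT i j k) _) (edge_expansion_eval cV C cE hlin).2.
rewrite [X in X + _ + _]big1 => [|a _]; last first.
  by rewrite big1 // => r _; rewrite beta_B // mulr0.
have he0 := side_is_edge hD h.
rewrite add0r /=; congr (_ + _).
  rewrite (bigD1 [ix i; j]) //= [X in _ + X]big1 ?addr0 => [|e /andP[he /negPf ne]].
    by apply: eq_bigr => l hl; rewrite betaF_BEFe // eqxx mul1r.
  by rewrite big1 // => l hl; rewrite betaF_BEFe // ne mul0r mulr0.
have z e : e \in bedges D -> e != [ix i; j] -> cE e * betaF P (BEBe e) i j k = 0.
  by move=> he /negPf ne; rewrite betaF_BEBe // ne mul0r mulr0.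
case: ifPn => hb; last first.
  by rewrite big1 // => e he; apply: z => //; apply: contraNneq hb => <-.
rewrite (bigD1 [ix i; j]) //= betaF_BEBe // eqxx mul1r big1 ?addr0 //.
by move=> e /andP[he ne]; exact: z.
Qed.

(* Both sides satisfy the same linear system relating the values on the two
   sides of an edge; its determinant 1 - om_k - om_k' vanishes only if the
   two split points coincide. *)
Lemma bl_wpt_expansion i j k : [ix i; j; k] \in tris D ->
  bl P S i j k (pos D i) (pos D j) (wpt D P [ix i; j] k) = C [ix i; j] k.
Proof.
move=> h; have he := side_is_edge hD h.
have hS : spline P S.
  have hlin := @beta_linear_on (DT i j k) h.
  exact: (edge_expansion_eval cV C cE hlin).1.
have pS : piecewise_cubic P S by have [] := hS.
set e := [ix i; j] in he *.
have hk : k \in thirds D e by rewrite inE.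
have [p [_ hp _]] := bl_piece hD hP pS h.
have Fk := betaF_expansion h; rewrite /betaF -/e in Fk.
have [hb|hb] := boolP (e \in bedges D).
  move: Fk; rewrite hb (boundary_thirds hD hb hk) big_set1 /weight eqxx.
  rewrite (om_boundary hom hb h) (blossom_comb2 hp).
  have := betaB_expansion hb; rewrite /betaB (third_boundary hD hb h) => ->.
  set o := om e k => E.
  (* Otherwise the split point would be v_ij, which lies on the edge. *)
  have o1 : 1 - o != 0.
    apply/eqP => o1; move/negP: (split_point_area hD hP h); apply.
    rewrite (om_boundary hom hb h) -/e -/o o1 scale0r add0r.
    have -> : o = 1 by lra.
    rewrite scale1r; have [s [_ ->]] := vE_segment hD hP h.
    by apply/eqP; rewrite /triangle_area !mxE; ring.
  by apply: (mulfI o1); move: E; rewrite -/e; lra.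
have [k' kk' K] := interior_thirds hD he hb hk.
have h' : [ix i; j; k'] \in tris D.
  by have : k' \in thirds D e; [rewrite K !inE eqxx orbT|rewrite inE].
have [p' [_ hp' _]] := bl_piece hD hP pS h'.
have Fk' := betaF_expansion h'; rewrite /betaF -/e in Fk'.
have k'k : k' != k by rewrite eq_sym.
have vk := om_interior hom he hb h h' kk'.
have vk' := om_interior hom he hb h' h k'k.
move: Fk Fk'; rewrite (negPf hb) !addr0 K !big_setU1 /= ?inE // !big_set1.
rewrite /weight !eqxx (negPf kk') (negPf k'k).
rewrite {1}vk {1}vk' (blossom_comb2 hp) (blossom_comb2 hp') -/e.
(* Each equation evaluates a piece at the point [wpt] of the other triangle. Crossing the edge
   leaves only the unknowns [x] and [x']. *)
rewrite (bl_across_edge hD hP (wpt D P e k') hS h h').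
rewrite -(bl_across_edge hD hP (wpt D P e k) hS h h').
set x := bl _ _ _ _ k _ _ _; set x' := bl _ _ _ _ k' _ _ _.
set o := om e k; set o' := om e k' => E E'.
have det : 1 - o - o' != 0.
  apply/eqP => d0.
  have tt' : [ix i; j; k] != [ix i; j; k'].
    apply/eqP => /finset.setP/(_ k); rewrite !inE eqxx orbT (negPf kk') orbF.
    have [_ ik jk] := tri_distinct hD h.
    by rewrite [k == i]eq_sym [k == j]eq_sym (negPf ik) (negPf jk).
  apply: (split_points_neq hD hP h h' tt').
  rewrite vk vk' -/e -/o -/o'; have -> : o' = 1 - o by lra.
  by apply: plane_eqP; rewrite !mxE; ring.
apply: (mulfI det).
(* This combination of the two equations eliminates [x'] on the left and [C e k'] on the right,
   leaving the determinant as common factor. *)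
have : (1 - o') * ((1 - o) * x + o * x') - o * ((1 - o') * x' + o' * x)
  = (1 - o') * (C e k * (1 - o) + C e k' * o) - o * (C e k' * (1 - o') + C e k * o').
  by rewrite E E'; ring.
by move=> F; lra.
Qed.

End Coefficients.

(** * The reduced basis as a family with dual functionals *)

Definition reduced_index : finType := (I * 'I_3 + {set I} + {set I} * I + {set I})%type.

(** Edges and triangles enter as unordered sets, so that different labellings of one function share
    an index. *)
Definition reduced_valid (d : reduced_index) : bool :=
  match d with
  | inl (inl (inl _)) => true
  | inl (inl (inr t)) => t \in symtris D P
  | inl (inr (e, k)) =>
      (e \in edges D) && (e :|: [set k] \in tris D :\: symtris D P)%SET
  | inr e => e \in bedges D
  end.

Definition reduced_fun (d : reduced_index) : fct R D :=
  match d with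
  | inl (inl (inl (i, r))) => B (DV i r)
  | inl (inl (inr t)) => BTT B om (labT L t).1.1 (labT L t).1.2 (labT L t).2
  | inl (inr (e, k)) => BEFe e k
  | inr e => BEBe e
  end.

Definition reduced_dual (d : reduced_index) (S : fct R D) : R :=
  match d with
  | inl (inl (inl (i, r))) => betaV P q L S i r
  | inl (inl (inr t)) => betaT P S (labT L t).1.1 (labT L t).1.2 (labT L t).2
  | inl (inr (e, k)) => betaF P S (labE L e).1 (labE L e).2 k
  | inr e => betaB P S (labE L e).1 (labE L e).2
  end.

Lemma reduced_sum (c : reduced_index -> R) :
  \sum_(d | reduced_valid d) c d *: reduced_fun d =
  expansion P L B om (fun i r => c (inl (inl (inl (i, r)))))
    (fun t => c (inl (inl (inr t)))) (fun e k => c (inl (inr (e, k))))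
    (fun e => c (inr e)).
Proof.
rewrite /expansion !big_sumType /= !pair_big_dep /=.
by congr (_ + _ + _ + _); apply: eq_big => -[].
Qed.

Lemma expansion_dual cV cT cEF cE
    (S := expansion P L B om cV cT cEF cE) :
  [/\ forall i r, betaV P q L S i r = cV i r,
      forall t, t \in symtris D P ->
        betaT P S (labT L t).1.1 (labT L t).1.2 (labT L t).2 = cT t,
      forall e k, e \in edges D ->
        (e :|: [set k] \in tris D :\: symtris D P)%SET ->
        betaF P S (labE L e).1 (labE L e).2 k = cEF e k
    & forall e, e \in bedges D -> betaB P S (labE L e).1 (labE L e).2 = cE e].
Proof.
rewrite /S expansionE; split=> [i r|t ht|e k he|e he].
- exact: betaV_expansion.
- have tE := labT_tri hL (symtris_tris ht).
  set i := (labT L t).1.1; set j := (labT L t).1.2; set k := (labT L t).2.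
  have h : [ix i; j; k] \in tris D by rewrite -tE; exact: symtris_tris.
  (* For a symmetric triangle [wpt] is v_k, so the recovered value is [betaT]; below, [wpt] is the
     split point and the value is [betaF]. *)
  have := bl_wpt_expansion cV (merged cT cEF) cE h.
  by rewrite /wpt /merged -tE ht.
- rewrite inE => /andP[hns ht]; have eE := labE_edge hL he.
  set i := (labE L e).1; set j := (labE L e).2.
  have h : [ix i; j; k] \in tris D by rewrite -eE.
  have := bl_wpt_expansion cV (merged cT cEF) cE h.
  by rewrite /wpt /merged -eE (negPf hns) /betaF -eE.
- have eE := labE_edge hL (bedge_edge he).
  by rewrite betaB_expansion -eE.
Qed.

Lemma reduced_dual_sum (c : reduced_index -> R) d : reduced_valid d ->
  reduced_dual d (\sum_(d | reduced_valid d) c d *: reduced_fun d) = c d.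
Proof.
rewrite reduced_sum; case: (expansion_dual (fun i r => c (inl (inl (inl (i, r)))))
    (fun t => c (inl (inl (inr t)))) (fun e k => c (inl (inr (e, k))))
    (fun e => c (inr e))) => hV hT hF hE.
case: d => [[[[i r]|t]|[e k]]|e] /=; [by move=> _; exact: hV|exact: hT| |exact: hE].
by move=> /andP[]; exact: hF.
Qed.

(** [SR] admits every labelling of an edge or triangle; symmetry of the combined functions brings
    each to the labels chosen by [L]. *)
Lemma SR_reduced_fun f : SR P B om f -> exists2 d, reduced_valid d & f = reduced_fun d.
Proof.
case=> [[i [r ->]]|[i [j [k [h ->]]]]|[i [j [k [h ->]]]]|[i [j [h ->]]]].
- by exists (inl (inl (inl (i, r)))).
- exists (inl (inl (inr [ix i; j; k]))) => //=.
  have tE := labT_tri hL (symtris_tris h).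
  by rewrite !BTT_sum -?tE //; exact: symtris_tris.
- have he : [ix i; j] \in edges D.
    by move: h; rewrite inE => /andP[_]; exact: (side_is_edge hD).
  exists (inl (inr ([ix i; j], k))); first by apply/andP.
  exact: BEF_edge.
- by exists (inr [ix i; j]) => //; exact: BEB_edge.
Qed.

End ReducedSpace.

Theorem theorem22 (R : realType) (I : finType) (D : complex R I)
  (hD : is_triangulation D)
  (P : split_points R I) (hP : is_ps_refinement D P)
  (q : I -> 'I_3 -> plane R) (hq : is_vertex_triangles D P q)
  (L : labelling I) (hL : is_labelling D L)
  (B : dof I -> fct R D) (hB : is_dual_basis P q L B)
  (om : {set I} -> I -> R) (hom : is_weights D P om) :
  is_basis (SR P B om) (reduced_space P B om) /\
  forall S : fct R D, reduced_space P B om S ->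
    let bV i r := betaV P q L S i r in
    let bT t := betaT P S (labT L t).1.1 (labT L t).1.2 (labT L t).2 in
    let bEF e k := betaF P S (labE L e).1 (labE L e).2 k in
    let bEB e := betaB P S (labE L e).1 (labE L e).2 in
    S = expansion P L B om bV bT bEF bEB /\
    forall (cV : I -> 'I_3 -> R) (cT : {set I} -> R)
      (cEF : {set I} -> I -> R) (cEB : {set I} -> R),
      S = expansion P L B om cV cT cEF cEB ->
      [/\ forall i r, cV i r = bV i r,
          forall t, t \in symtris D P -> cT t = bT t,
          forall e k, e \in edges D ->
            (e :|: [set k])%SET \in (tris D :\: symtris D P)%SET ->
            cEF e k = bEF e k
        & forall e, e \in bedges D -> cEB e = bEB e].
Proof.
have SRG := SR_reduced_fun hD hL (P := P) (B := B) (om := om).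
have dual := reduced_dual_sum hD hP hL hB hom.
(* The spanning half holds by definition of [reduced_space]. *)
split; first by split; [exact: dual_family_indep SRG dual|].
move=> S hS bV bT bEF bEB; split.
  by rewrite [LHS](dual_family_expansion SRG dual hS) reduced_sum.
(* Uniqueness: the functionals read the coefficients off any expansion. *)
move=> cV cT cEF cEB SE; rewrite /bV /bT /bEF /bEB SE.
have [hV hT hF hE] := expansion_dual hD hP hL hB hom cV cT cEF cEB.
by split=> *; apply/esym; [exact: hV|exact: hT|exact: hF|exact: hE].
Qed.
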